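(* Let $\eta>1$ and $2<s<4$. There exists a sequence of i.i.d. real random variables $(X_n)_{n\ge1}$ with $\mathbf E X_1=0$, $\mathbf E X_1^2=1$, $\mathbf E|X_1|^s<+\infty$ and $D(X_1)<+\infty$, such that for $Z_n=(X_1+\dots+X_n)/\sqrt n$, $$D(Z_n)\ge\frac{c(\eta)}{(n\log n)^{(s-2)/2}(\log n)^{\eta}}\qquad\text{for all } n\ge n_1(X_1),$$ where $c(\eta)>0$ is a constant depending only on $\eta$ and $n_1(X_1)$ depends on the distribution of $X_1$.
   Context: $D(X)=\int p\log(p/\varphi_{a,\sigma})$ is the relative entropy of $X$ (with density $p$, mean $a$, variance $\sigma^2$) with respect to the normal law $N(a,\sigma^2)$ with density $\varphi_{a,\sigma}$. *)

(* Defs.v *)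
From HB Require Import structures.
From mathcomp Require Import all_boot all_order all_algebra.
From mathcomp Require Import all_classical all_reals all_analysis.
Set Implicit Arguments. Unset Strict Implicit. Unset Printing Implicit Defensive.
Import Order.TTheory GRing.Theory Num.Theory.
Import numFieldNormedType.Exports.
Local Open Scope classical_set_scope.
Local Open Scope ring_scope.

Section defs.
Context {d : measure_display} {T : measurableType d} {R : realType}.
Variable P : probability T R.

Definition mutually_independent (X : nat -> T -> R) : Prop :=
  forall (I : seq nat) (B : nat -> set R), uniq I ->
    (forall i, measurable (B i)) ->
    P (\bigcap_(i in [set` I]) (X i @^-1` B i)) =
    (\prod_(i <- I) P (X i @^-1` B i))%E.

Definition identically_distributed (X : nat -> T -> R) : Prop :=
  forall n (A : set R), measurable A -> P (X n @^-1` A) = P (X 0%N @^-1` A).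

Definition iid (X : nat -> T -> R) : Prop :=
  mutually_independent X /\ identically_distributed X.

Definition is_density (f : T -> R) (p : R -> R) : Prop :=
  [/\ measurable_fun setT p, (forall x, 0 <= p x) &
      forall A : set R, measurable A ->
        P (f @^-1` A) = (\int[lebesgue_measure]_(x in A) (p x)%:E)%E].

(* int p log (p / phi_{a,sigma}) (with 0 log 0 = 0) *)
Definition rel_entropy_normal (p : R -> R) (a sigma : R) : \bar R :=
  (\int[lebesgue_measure]_x ((p x) * ln (p x / normal_pdf a sigma x))%:E)%E.

(* D(f): relative entropy of f w.r.t. the normal law with the same mean a
   and variance sigma^2; +oo if f has no density (densities are a.e. unique,
   so the infimum is over a set with one value). *)
Definition D (f : T -> R) : \bar R :=
  let a := fine ('E_P[f])%E in
  let sigma := Num.sqrt (fine ('V_P[f])%E) in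
  ereal_inf [set rel_entropy_normal p a sigma | p in is_density f].

End defs.

(* Z_n = (X_1 + ... + X_n)/sqrt n, with X_k written X (k-1) *)
Definition normalized_sum {d : measure_display} {T : measurableType d}
  {R : realType} (X : nat -> T -> R) (n : nat) : T -> R :=
  fun w => (\sum_(i < n) X i w) / Num.sqrt n%:R.

(* Main.v *)
Require Import Defs.
From HB Require Import structures.
From mathcomp Require Import all_boot all_order all_algebra.
From mathcomp Require Import all_classical all_reals all_analysis.
From mathcomp Require Import measurable_realfun ring lra.
Set Implicit Arguments. Unset Strict Implicit. Unset Printing Implicit Defensive.
Import Order.TTheory GRing.Theory Num.Theory.
Import numFieldNormedType.Exports.
Local Open Scope classical_set_scope.
Local Open Scope ring_scope.

(** Take [X] symmetric with a bounded density, variance 1 and a tail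
    [P(|X| > t)] of order [t^-s (log t)^-eta]; since [eta > 1] the [s]-th moment
    is finite. For [t = sqrt (12 n log n)], symmetry and a single big jump give
    [P(|X_1 + ... + X_n| > t) >= n P(X > t) / 2], so [Z_n] exceeds
    [sqrt (12 log n)] with a probability [pi] of order
    [n (n log n)^(-s/2) (log n)^-eta >= n^(-1-o(1))], whereas the standard normal
    law does so with probability [O(n^-3)]. By the variational formula for
    relative entropy any such discrepancy forces
    [D(Z_n) >= pi log n - O(n^-2)], which is the announced lower bound; since [D]
    is an infimum over densities, [Z_n] need not be shown to have one.

    The i.i.d. sequence lives on the space of coin tossing sequences: the
    even-indexed bits produce [X_1] through its quantile function, and the
    odd-indexed bits are again a fair coin tossing sequence from which the
    remaining variables are produced in the same way. *)

Lemma measurable_preimageT d d' (T : measurableType d) (U : measurableType d')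
    (f : T -> U) (A : set U) :
  measurable_fun setT f -> measurable A -> measurable (f @^-1` A).
Proof. by move=> mf mA; rewrite -[X in measurable X]setTI; exact: mf. Qed.

Lemma measurable_set_ler d (T : measurableType d) (R : realType) (f g : T -> R) :
  measurable_fun setT f -> measurable_fun setT g -> measurable [set x | f x <= g x].
Proof. by move=> mf mg; rewrite -[X in measurable X]setTI; exact: measurable_fun_le. Qed.

Lemma measurable_set_ltr d (T : measurableType d) (R : realType) (f g : T -> R) :
  measurable_fun setT f -> measurable_fun setT g -> measurable [set x | f x < g x].
Proof.
move=> mf mg; rewrite (_ : [set x | _] = ~` [set x | g x <= f x]).
  exact/measurableC/measurable_set_ler.
by apply/seteqP; split=> x /=; rewrite ltNge => /negP.
Qed.

Lemma measurable_normr_powR (R : realType) (r : R) :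
  measurable_fun setT (fun x : R => `|x| `^ r).
Proof. by apply: (measurableT_comp (measurable_powR _)); exact: normr_measurable. Qed.

Lemma ge0_integrable d (T : measurableType d) (R : realType)
    (mu : {measure set T -> \bar R}) (f : T -> R) :
  measurable_fun setT f -> (forall x, 0 <= f x) ->
  (\int[mu]_x (f x)%:E < +oo)%E -> mu.-integrable setT (EFin \o f).
Proof.
move=> mf f0 foo; apply/integrableP; split; first exact/measurable_EFinP.
by under eq_integral do rewrite /= ger0_norm//.
Qed.

Lemma finite_measure_g_sigma_unique d (T : measurableType d) (R : realType)
    (G : set (set T)) (m1 m2 : {measure set T -> \bar R}) :
  G `<=` measurable -> setI_closed G -> (forall A, G A -> m1 A = m2 A) ->
  m1 setT = m2 setT -> (m1 setT < +oo)%E ->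
  forall A, <<s G >> A -> m1 A = m2 A.
Proof.
move=> Gm GI m12 m12T m1oo A sGA; pose GT := G `|` [set setT].
apply: (g_sigma_algebra_measure_unique GT _ (fun=> setT)) => //.
- by move=> _ [/Gm//|->]; exact: measurableT.
- by move=> _; right.
- by rewrite bigcup_const//; exists 0%N.
- move=> B C [GB|->]; last by rewrite setTI.
  by case=> [GC|->]; [left; exact: GI|rewrite setIT; left].
- by move=> B [/m12//|->].
- by apply: sub_sigma_algebra2 sGA => B; left.
Qed.

Lemma eq_law_g_sigma d d' (T : measurableType d) (U : measurableType d')
    (R : realType) (P : probability T R) (Q : probability U R) (f : T -> U)
    (G : set (set U)) :
  measurable_fun setT f -> measurable = <<s G >> -> setI_closed G ->
  (forall A, G A -> P (f @^-1` A) = Q A) ->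
  forall A, measurable A -> P (f @^-1` A) = Q A.
Proof.
move=> mf mG GI PQ A mA; pose m : {measure set U -> \bar R} := pushforward P f.
have mE B : m mf B = P (f @^-1` B) by [].
rewrite -mE; apply: (@finite_measure_g_sigma_unique _ _ _ G (m mf)) => //.
- by rewrite mG; exact: sub_gen_smallest.
- by rewrite mE preimage_setT probability_setT; exact/esym/probability_setT.
- by rewrite mE preimage_setT probability_setT ltry.
- by rewrite -mG.
Qed.

Section independent_pair.
Context d d1 d2 (T : measurableType d) (T1 : measurableType d1)
  (T2 : measurableType d2) (R : realType) (P : probability T R).
Local Open Scope ereal_scope.

Definition independent_pair (f : T -> T1) (g : T -> T2) :=
  forall A B, measurable A -> measurable B ->
    P (f @^-1` A `&` g @^-1` B) = P (f @^-1` A) * P (g @^-1` B).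

End independent_pair.

Section independent_pair_theory.
Context d (T : measurableType d) (R : realType) (P : probability T R).
Local Open Scope ereal_scope.

Lemma independent_event_g_sigma d' (U : measurableType d') (f : T -> U)
    (G : set (set U)) (E : set T) :
  measurable_fun setT f -> measurable = <<s G >> -> setI_closed G ->
  measurable E ->
  (forall A, G A -> P (E `&` f @^-1` A) = P E * P (f @^-1` A)) ->
  forall A, measurable A -> P (E `&` f @^-1` A) = P E * P (f @^-1` A).
Proof.
move=> mf mG GI mE indG A mA.
have PE0 : (0 <= fine (P E))%R by exact: fine_ge0.
pose m1 : {measure set U -> \bar R} := pushforward (mrestr P mE) f.
pose m2 : {measure set U -> \bar R} := mscale (NngNum PE0) (pushforward P f).
have m1E B : m1 mf B = P (E `&` f @^-1` B) by rewrite setIC.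
have m2E B : m2 mf B = P E * P (f @^-1` B).
  by rewrite /m2/= /mscale/= fineK ?fin_num_measure.
rewrite -m1E -m2E; apply: (@finite_measure_g_sigma_unique _ _ _ G).
- by rewrite mG; exact: sub_gen_smallest.
- exact: GI.
- by move=> B GB; rewrite m1E m2E indG.
- by rewrite m1E m2E preimage_setT setIT probability_setT mule1.
- by rewrite m1E preimage_setT setIT -ge0_fin_numE// fin_num_measure.
- by rewrite -mG.
Qed.

Lemma independent_pair_g_sigma d1 d2 (T1 : measurableType d1)
    (T2 : measurableType d2) (f : T -> T1) (g : T -> T2)
    (G1 : set (set T1)) (G2 : set (set T2)) :
  measurable_fun setT f -> measurable_fun setT g ->
  measurable = <<s G1 >> -> measurable = <<s G2 >> ->
  setI_closed G1 -> setI_closed G2 ->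
  (forall A B, G1 A -> G2 B ->
    P (f @^-1` A `&` g @^-1` B) = P (f @^-1` A) * P (g @^-1` B)) ->
  independent_pair P f g.
Proof.
move=> mf mg mG1 mG2 G1I G2I indG A B mA mB.
have mgB : measurable (g @^-1` B) by exact: measurable_preimageT.
rewrite setIC muleC; apply: independent_event_g_sigma (G1I) mgB _ _ mA => //.
move=> C GC; have mC : measurable C by rewrite mG1; exact: sub_gen_smallest.
rewrite setIC muleC; apply: independent_event_g_sigma (G2I) _ _ _ mB => //.
  exact: measurable_preimageT.
by move=> D GD; exact: indG.
Qed.

End independent_pair_theory.

Lemma subset_iota (I : seq nat) : exists n, {subset I <= iota 0 n}.
Proof.
exists (\max_(i <- I) i).+1 => i iI; rewrite mem_iota ltnS.
exact: leq_bigmax_seq.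
Qed.

(** * Fair coin tossing *)

Section bit_sequence.
Implicit Types (I : seq nat) (e x : nat -> bool).

Definition cylinder I e : set (nat -> bool) := [set x : nat -> bool | {in I, x =1 e}].

Definition cylinders : set (set (nat -> bool)) :=
  [set A | A = set0 \/ exists2 I, uniq I & exists e, A = cylinder I e].

Definition bit_sequence := g_sigma_algebraType cylinders.

HB.instance Definition _ := Measurable.on bit_sequence.

Lemma cylinder_nil e : cylinder [::] e = setT.
Proof. by apply/seteqP; split. Qed.

Lemma eq_cylinder I e e' : {in I, e =1 e'} -> cylinder I e = cylinder I e'.
Proof.
move=> ee'; apply/seteqP; split=> x xe k kI; first by rewrite xe// ee'.
by rewrite xe// ee'.
Qed.

Lemma eq_mem_cylinder I J e : I =i J -> cylinder I e = cylinder J e.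
Proof. by move=> IJ; apply/seteqP; split=> x xe k; [rewrite -IJ|rewrite IJ]; exact: xe. Qed.

Lemma cylinder_cat I J e : cylinder (I ++ J) e = cylinder I e `&` cylinder J e.
Proof.
apply/seteqP; split=> x; last by move=> [xI xJ] k; rewrite mem_cat => /orP[/xI|/xJ].
by move=> xe; split=> k kI; apply: xe; rewrite mem_cat kI ?orbT.
Qed.

Lemma cylinder_setI_disjoint I J e e' : ~~ has (mem I) J ->
  cylinder I e `&` cylinder J e' =
  cylinder (I ++ J) (fun k => if k \in I then e k else e' k).
Proof.
move=> /hasPn dIJ; rewrite cylinder_cat; congr (_ `&` _); apply: eq_cylinder => k.
  by move=> ->.
by move=> /dIJ /= /negbTE ->.
Qed.

Lemma cylinders_cylinder I e : cylinders (cylinder I e).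
Proof.
right; exists (undup I); first exact: undup_uniq.
by exists e; apply: eq_mem_cylinder => k; rewrite mem_undup.
Qed.

Lemma setI_closed_cylinders : setI_closed cylinders.
Proof.
move=> A B [->|[I _ [e ->]]]; first by rewrite set0I; left.
case=> [->|[J _ [e' ->]]]; first by rewrite setI0; left.
have [[x [xe xe']]|IJ0] := pselect (cylinder I e `&` cylinder J e' !=set0).
  rewrite (_ : cylinder I e = cylinder I x); last by apply: eq_cylinder => k /xe.
  rewrite (_ : cylinder J e' = cylinder J x); last by apply: eq_cylinder => k /xe'.
  by rewrite -cylinder_cat; exact: cylinders_cylinder.
by left; apply/eqP/negP => /negP/set0P.
Qed.

Lemma measurable_cylinder I e : measurable (cylinder I e : set bit_sequence).
Proof. by apply: sub_sigma_algebra; exact: cylinders_cylinder. Qed.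

Lemma measurable_bit k : measurable_fun [set: bit_sequence] (fun x : bit_sequence => x k).
Proof.
apply: (measurable_fun_bool true).
rewrite setTI (_ : _ @^-1` _ = cylinder [:: k] (fun=> true)).
  exact: measurable_cylinder.
apply/seteqP; split=> x /= xk; last by apply: xk; rewrite inE.
by move=> j; rewrite inE => /eqP ->.
Qed.

Lemma measurable_fun_bits d (T : measurableType d) (f : T -> bit_sequence) :
  (forall k, measurable_fun setT (fun t => f t k)) -> measurable_fun setT f.
Proof.
move=> mf; apply: (@measurability _ _ T bit_sequence setT f cylinders) => //.
move=> _ [_ [->|[I _ [e ->]]] <-].
  by rewrite preimage_set0 setI0; exact: measurable0.
rewrite setTI (_ : _ @^-1` _ =
    \bigcap_(k in [set` I]) ((fun t => f t k) @^-1` [set e k])).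
  by apply: bigcap_measurableType => k _; exact: measurable_preimageT.
by apply/seteqP; split=> t.
Qed.

Definition reindex (phi : nat -> nat) (x : bit_sequence) : bit_sequence := x \o phi.

Lemma measurable_reindex phi :
  measurable_fun setT (reindex phi).
Proof. by apply: measurable_fun_bits => k; exact: measurable_bit. Qed.

Lemma preimage_reindex_cylinder phi psi I e : cancel phi psi ->
  reindex phi @^-1` cylinder I e = cylinder (map phi I) (e \o psi).
Proof.
move=> phiK; apply/seteqP; split=> x xe k /=.
  by move=> /mapP[j jI ->]; rewrite phiK; exact: xe.
by move=> kI; have := xe (phi k) (map_f _ kI); rewrite /= phiK.
Qed.

End bit_sequence.

Section binary_digits.
Context {R : realType}.
Implicit Types (x : R) (w : bit_sequence).

Definition doubling x : R := if 2^-1 <= x then 2 * x - 1 else 2 * x.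

Definition binary_digits x : bit_sequence := fun k => 2^-1 <= iter k doubling x.

Definition binary_sum n w : R := \sum_(k < n) (w k)%:R / 2 ^+ k.+1.

Definition binary_value w : R := limn (binary_sum^~ w).

Lemma doubling_itv x : 0 <= x < 1 -> 0 <= doubling x < 1.
Proof. by rewrite /doubling; case: ifPn => h; lra. Qed.

Lemma iter_doubling_itv k x : 0 <= x < 1 -> 0 <= iter k doubling x < 1.
Proof. by move=> x01; elim: k => //= k; exact: doubling_itv. Qed.

Lemma measurable_doubling : measurable_fun setT doubling.
Proof.
apply: measurable_fun_ifT => //; first exact: measurable_fun_ler.
by apply: measurable_funB => //; exact: measurable_funM.
Qed.

Lemma measurable_binary_digits : measurable_fun setT binary_digits.
Proof.
apply: measurable_fun_bits => k; apply: measurable_fun_ler => //.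
elim: k => [|k ih]; first exact: measurable_id.
exact: (measurableT_comp measurable_doubling ih).
Qed.

Lemma binary_sum_digits n x :
  binary_sum n (binary_digits x) = x - iter n doubling x / 2 ^+ n.
Proof.
rewrite /binary_sum; elim: n => [|n ih]; first by rewrite big_ord0/= expr0 divr1 subrr.
rewrite big_ord_recr/= ih /binary_digits exprS.
move: (iter n doubling x) => y; rewrite /doubling.
by case: ifPn => _ /=; field; rewrite expf_neq0.
Qed.

Lemma binary_sum_itv n w : 0 <= binary_sum n w <= 1 - 2^-1 ^+ n.
Proof.
rewrite /binary_sum; elim: n => [|n ih]; first by rewrite big_ord0 expr0 subrr lexx.
rewrite big_ord_recr/= -exprVn exprS.
have : 0 <= 2^-1 ^+ n :> R by exact: exprn_ge0.
by case: (w n) => /=; lra.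
Qed.

Lemma binary_digits_cylinder n e x : 0 <= x < 1 ->
  cylinder (iota 0 n) e (binary_digits x) <->
  binary_sum n e <= x < binary_sum n e + 2^-1 ^+ n.
Proof.
move=> x01; elim: n => [|n ih].
  by rewrite cylinder_nil /binary_sum big_ord0 expr0 add0r x01.
have -> : binary_sum n.+1 e = binary_sum n e + (e n)%:R / 2 * 2^-1 ^+ n.
  by rewrite /binary_sum big_ord_recr/= exprS exprVn; field; rewrite expf_neq0.
rewrite -addn1 iotaD cylinder_cat add0n exprD expr1.
have u0 : 0 < 2^-1 ^+ n :> R by exact: exprn_gt0.
have bitE : binary_sum n e = binary_sum n (binary_digits x) ->
    (binary_digits x n = e n <-> binary_sum n e + (e n)%:R / 2 * 2^-1 ^+ n <= x <
      binary_sum n e + (e n)%:R / 2 * 2^-1 ^+ n + 2^-1 ^+ n * 2^-1).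
  have := iter_doubling_itv n x01; rewrite binary_sum_digits -exprVn => y01 ->.
  rewrite {1}/binary_digits; move: (iter n doubling x) y01 => y y01.
  have -> : (x - y * 2^-1 ^+ n + (e n)%:R / 2 * 2^-1 ^+ n <= x <
      x - y * 2^-1 ^+ n + (e n)%:R / 2 * 2^-1 ^+ n + 2^-1 ^+ n * 2^-1) =
      ((e n)%:R / 2 <= y < (e n)%:R / 2 + 2^-1).
    rewrite -(ler_pM2r u0 _ y) -(ltr_pM2r u0 y); congr (_ && _).
      by apply/idP/idP; lra.
    by apply/idP/idP; lra.
  by case: (e n) => /=; case: leP => h; split=> //; lra.
have sumE : cylinder (iota 0 n) e (binary_digits x) ->
    binary_sum n e = binary_sum n (binary_digits x).
  by move=> xe; apply: eq_bigr => k _; rewrite xe// mem_iota/=.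
have bitn : cylinder (iota n 1) e (binary_digits x) <-> binary_digits x n = e n.
  split=> [|xn k]; first by apply; rewrite inE.
  by rewrite inE => /eqP ->.
split=> [[xe /bitn xn]|xitv]; first by apply/(bitE (sumE xe)).
have xe : cylinder (iota 0 n) e (binary_digits x).
  by apply/ih; move: xitv; case: (e n) => /=; lra.
by split=> //; apply/bitn/(bitE (sumE xe)).
Qed.

Lemma binary_value_digits x : 0 <= x < 1 -> binary_value (binary_digits x) = x.
Proof.
move=> x01; apply/cvg_lim => //.
rewrite (_ : binary_sum^~ _ = (fun n => x - iter n doubling x / 2 ^+ n)); last first.
  by apply/funext => n; exact: binary_sum_digits.
rewrite -[X in _ --> X](subr0 x).
apply: (@cvgB _ R^o); first exact: cvg_cst.
apply: (@squeeze_cvgr _ _ _ _ (cst 0) (fun n => 2^-1 ^+ n)).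
- apply: nearW => n; have /andP[y0 y1] := iter_doubling_itv n x01.
  by rewrite divr_ge0//= -exprVn ler_piMl ?exprn_ge0// ltW.
- exact: cvg_cst.
- by apply: cvg_expr; rewrite ger0_norm; lra.
Qed.

Lemma measurable_binary_value : measurable_fun setT binary_value.
Proof.
apply: (@measurable_fun_cvg _ _ _ _ binary_sum) => [n|w _].
  apply: measurable_sum => k; apply: measurable_funM => //.
  have -> : (fun w => (w k)%:R : R) = (fun w => if w k then 1 else 0).
    by apply/funext => w; case: (w k).
  by apply: measurable_fun_ifT => //; exact: measurable_bit.
apply: nondecreasing_is_cvgn.
  by apply/nondecreasing_seqP => n; rewrite /binary_sum big_ord_recr/= lerDl divr_ge0.
exists 1 => _ [n _ <-]; have /andP[_] := binary_sum_itv n w.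
by move=> /le_trans; apply; rewrite gerBl exprn_ge0.
Qed.

End binary_digits.

Lemma uniform_probE (R : realType) (a b : R) (ab : a < b) (b0 b1 : bool) (A : set R) :
  measurable A -> uniform_prob ab A = ((b - a)^-1%:E *
    lebesgue_measure (A `&` [set` Interval (BSide b0 a) (BSide b1 b)]))%E.
Proof.
move=> mA; rewrite -integral_cst; last exact: measurableI.
rewrite /uniform_prob integral_uniform_pdf !(setIC A) !integral_mkcondr.
have mcA D : measurable_fun D ((fun=> (b - a)^-1%:E) \_ A).
  by apply: measurable_funTS; exact/(measurable_restrictT _ mA).
rewrite [RHS]integral_itv_bndoo// -(@integral_itv_bndoo _ a b _ true false)//.
apply: eq_integral => x; rewrite inE/= in_itv/= => xab.
by rewrite !patchE /uniform_pdf xab.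
Qed.

Section coin.
Context {R : realType}.
Local Notation unif := (uniform_prob (@ltr01 R)).
Implicit Types (I J : seq nat) (e : nat -> bool).

Lemma uniform_prob01E (b0 b1 : bool) (A : set R) : measurable A ->
  unif A = lebesgue_measure (A `&` [set` Interval (BSide b0 0) (BSide b1 1)]).
Proof. by move=> mA; rewrite (uniform_probE _ b0 b1)// subr0 invr1 mul1e. Qed.

HB.instance Definition _ := @isMeasurableFun.Build _ _ _ _
  (@binary_digits R : measurableTypeR R -> bit_sequence) (@measurable_binary_digits R).

Definition coin : probability bit_sequence R :=
  distribution unif (@binary_digits R : {mfun measurableTypeR R >-> bit_sequence}).

Lemma coin_iota n e : coin (cylinder (iota 0 n) e) = (2^-1 ^+ n)%:E.
Proof.
have [/andP[s0 s1] mC] := (@binary_sum_itv R n e, measurable_cylinder (iota 0 n) e).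
rewrite [LHS](uniform_prob01E true true); last first.
  by apply: measurable_preimageT mC; exact: measurable_binary_digits.
rewrite (_ : _ `&` _ = `[binary_sum n e, binary_sum n e + 2^-1 ^+ n[%classic).
  rewrite lebesgue_measure_itv/= lte_fin ltrDl exprn_gt0//.
  by rewrite -EFinB addrAC subrr add0r.
apply/seteqP; split=> x /=; rewrite !in_itv/=; first by move=> [/binary_digits_cylinder].
move=> xs; have x01 : 0 <= x < 1 by lra.
by split=> //; apply/binary_digits_cylinder.
Qed.

Lemma coin_cylinder_cons I e k : k \notin I ->
  coin (cylinder I e) = (coin (cylinder (k :: I) [eta e with k |-> true]) +
    coin (cylinder (k :: I) [eta e with k |-> false]))%E.
Proof.
move=> kI; rewrite -measureU; try exact: measurable_cylinder.
- congr (coin _); apply/seteqP; split=> x.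
    move=> xe; case xk : (x k); [left|right]; move=> j; rewrite inE /=;
      by have [->|_ /=] := eqVneq j k; [rewrite xk|exact: xe].
  move=> xe j jI; have jk : j != k by apply: contraNneq kI => <-.
  by case: xe => /(_ j); rewrite inE jI orbT /= (negbTE jk); exact.
- rewrite -subset0 => x [/(_ k) + /(_ k)].
  by rewrite inE eqxx /= eqxx => /(_ isT) -> /(_ isT).
Qed.

(* [coin_cylinder_cons] removes the constraint on one bit at a time, starting
   from the cylinders that prescribe all of the first bits. *)
Lemma coin_cylinder I e : uniq I -> coin (cylinder I e) = (2^-1 ^+ size I)%:E.
Proof.
move=> uI; have [n In] := subset_iota I.
pose J := [seq k <- iota 0 n | k \notin I].
have : perm_eq (J ++ I) (iota 0 n).
  apply: uniq_perm => [||k].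
  - rewrite cat_uniq uI filter_uniq ?iota_uniq// andbT.
    by apply/hasPn => k kI /=; rewrite mem_filter kI.
  - exact: iota_uniq.
  - by rewrite mem_cat mem_filter; have [/In|] := boolP (k \in I); rewrite ?orbF.
move: J => J {In}; elim: J I {uI} e => [|k J ih] I e IJ.
  by rewrite (eq_mem_cylinder e (perm_mem IJ)) coin_iota (perm_size IJ) size_iota.
have /andP[kI _] : (k \notin J ++ I) && uniq (J ++ I).
  by rewrite -cons_uniq (perm_uniq IJ) iota_uniq.
rewrite (@coin_cylinder_cons _ _ k); last by apply: contra kI; rewrite mem_cat orbC => ->.
have JkI : perm_eq (J ++ k :: I) (iota 0 n) by rewrite (perm_catCA J [:: k]).
by rewrite !ih//= -EFinD exprS; congr (_%:E); field.
Qed.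

Lemma coin_cylinder_setI I J e e' : uniq I -> uniq J -> ~~ has (mem I) J ->
  coin (cylinder I e `&` cylinder J e') =
  (coin (cylinder I e) * coin (cylinder J e'))%E.
Proof.
move=> uI uJ IJ; rewrite cylinder_setI_disjoint// !coin_cylinder//.
  by rewrite size_cat exprD EFinM.
by rewrite cat_uniq uI IJ.
Qed.

Lemma coin_reindex phi psi (A : set bit_sequence) : cancel phi psi ->
  measurable A -> coin (reindex phi @^-1` A) = coin A.
Proof.
move=> phiK mA; apply: (@eq_law_g_sigma _ _ bit_sequence bit_sequence _ coin _ _ cylinders) => //.
- exact: measurable_reindex.
- exact: setI_closed_cylinders.
- move=> _ [->|[I uI [e ->]]]; first by rewrite preimage_set0 !measure0.
  rewrite (preimage_reindex_cylinder _ _ phiK) !coin_cylinder ?size_map//.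
  by rewrite map_inj_uniq//; exact: can_inj phiK.
Qed.

Lemma independent_reindex phi psi phi' psi' : cancel phi psi -> cancel phi' psi' ->
  (forall i j, phi i != phi' j) ->
  independent_pair coin (reindex phi) (reindex phi').
Proof.
move=> phiK phi'K phiN.
apply: (@independent_pair_g_sigma _ _ _ _ _ _ bit_sequence bit_sequence _ _ cylinders cylinders);
  [exact: measurable_reindex|exact: measurable_reindex|by []|by []|
   exact: setI_closed_cylinders|exact: setI_closed_cylinders|].
move=> _ _ [->|[I uI [e ->]]] [->|[J uJ [e' ->]]];
  rewrite ?preimage_set0 ?set0I ?setI0 ?measure0 ?mule0 ?mul0e//.
rewrite (preimage_reindex_cylinder _ _ phiK) (preimage_reindex_cylinder _ _ phi'K).
apply: coin_cylinder_setI; rewrite ?map_inj_uniq//; try exact: can_inj; last first.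
apply/hasPn => _ /mapP[j _ ->]; apply/mapP => -[i _ /eqP]; rewrite eq_sym.
by rewrite (negbTE (phiN _ _)).
Qed.

End coin.

(** * Inverse transform sampling *)

Section quantile.
Context {R : realType}.
Variable F : R -> R.
Hypotheses (F_nd : nondecreasing F) (F_rc : right_continuous F).
Hypotheses (FNy : F @ -oo --> (0 : R)) (Fy : F @ +oo --> (1 : R)).

Definition quantile (u : R) : R := if 0 < u < 1 then inf [set x | u <= F x] else 0.

Let has_inf_superlevel u : 0 < u < 1 -> has_inf [set x | u <= F x].
Proof.
move=> /andP[u0 u1]; split.
  by have [M [_ MF]] := @cvgr_ge _ _ _ _ _ _ Fy _ u1; exists (M + 1); apply: MF; rewrite ltrDl.
have [M [_ MF]] := @cvgr_lt _ _ _ _ _ _ FNy _ u0.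
exists (M - 1) => x /= uFx; rewrite leNgt; apply/negP => /ltW/F_nd.
by apply/negP; rewrite -ltNge (lt_le_trans _ uFx)// MF// gtrBl.
Qed.

Lemma lt_quantile u x : 0 < u < 1 -> (x < quantile u) = (F x < u).
Proof.
move=> u01; have Su := has_inf_superlevel u01; rewrite /quantile u01.
apply/idP/idP => [xQ|Fxu].
  by rewrite ltNge; apply/negP => /(ge_inf Su.2); rewrite leNgt xQ.
rewrite ltNge; apply: contraTN Fxu => Qx; rewrite -leNgt.
apply: (cvgr_to_ge (@F_rc x)); near=> y.
have xy : 0 < y - x by rewrite subr_gt0.
have [z uFz zy] := inf_adherent xy Su.
by apply: le_trans uFz (F_nd _); lra.
Unshelve. all: by end_near. Qed.

Lemma measurable_quantile : measurable_fun setT quantile.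
Proof.
apply: (measurability _ (RGenOInfty.measurableE R)) => // _ [_ [x ->] <-].
rewrite setTI (_ : _ @^-1` _ = (`]0, 1[ `&` `]F x, +oo[) `|`
    (~` `]0, 1[ `&` [set u | x < 0])).
  apply: measurableU; first exact: measurableI.
  by apply: measurableI; [exact: measurableC|exact: measurable_set_ltr].
apply/seteqP; split=> u /=; rewrite !in_itv/= !andbT; have [u01|u01] := boolP (0 < u < 1).
- by rewrite lt_quantile//; left.
- by rewrite {1}/quantile (negbTE u01) => x0; right.
- by rewrite lt_quantile// => -[[]|[]].
- by rewrite /quantile (negbTE u01) => -[[]|[]].
Qed.

Lemma uniform_quantile x :
  uniform_prob (@ltr01 R) (quantile @^-1` `]x, +oo[) = (1 - F x)%:E.
Proof.
have F0 : 0 <= F x.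
  by apply: (cvgr_to_le FNy); near=> y; apply: F_nd; near: y; exact/nbhs_ninfty_le/num_real.
have F1 : F x <= 1.
  by apply: (cvgr_to_ge Fy); near=> y; apply: F_nd; near: y; exact/nbhs_pinfty_ge/num_real.
rewrite (uniform_prob01E false true); last exact: measurable_preimageT measurable_quantile _.
rewrite (_ : _ `&` _ = `]F x, 1[%classic).
  rewrite lebesgue_measure_itv/= lte_fin -EFinB; case: ltP => // Fx1.
  by congr (_%:E); lra.
apply/seteqP; split=> u /=; rewrite !in_itv/= andbT.
  by move=> [+ u01]; rewrite lt_quantile// => ->; case/andP: u01.
move=> /andP[Fu u1]; have u01 : 0 < u < 1 by rewrite (le_lt_trans F0).
by rewrite lt_quantile.
Unshelve. all: by end_near. Qed.

End quantile.

Lemma probability_gt_unique (R : realType) d (T : measurableType d) (P : probability T R)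
    (mu : probability (measurableTypeR R) R) (f : T -> measurableTypeR R) :
  measurable_fun setT f ->
  (forall x, P (f @^-1` `]x, +oo[) = mu `]x, +oo[%classic) ->
  forall A, measurable A -> P (f @^-1` A) = mu A.
Proof.
move=> mf fmu; apply: (@eq_law_g_sigma _ _ T (measurableTypeR R) _ P mu f (@RGenOInfty.G R)) => //.
- exact: RGenOInfty.measurableE.
- move=> _ _ [x ->] [y ->]; exists (Num.max x y).
  by apply/seteqP; split=> z /=; rewrite !in_itv/= !andbT gt_max => /andP.
- by move=> _ [x ->].
Qed.

Section inverse_transform.
Context {R : realType}.
Local Notation unif := (uniform_prob (@ltr01 R)).

Let idR : measurableTypeR R -> R := idfun.

#[local] HB.instance Definition _ :=
  @isMeasurableFun.Build _ _ _ _ idR (@measurable_id _ _ setT).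

Lemma inverse_transform_sampling (mu : probability (measurableTypeR R) R) :
  exists2 Q : R -> R, measurable_fun setT Q &
    forall A, measurable A -> unif (Q @^-1` A) = mu A.
Proof.
pose X : {RV mu >-> R} := idR; pose F x := fine (cdf X x).
have FE x : mu `]-oo, x]%classic = (F x)%:E by rewrite /F fineK// fin_num_measure.
have F_nd : nondecreasing F.
  by move=> x y xy; apply: fine_le; rewrite ?fin_num_measure//; exact: cdf_nondecreasing.
have F_rc : right_continuous F.
  by move=> x; apply: fine_cvg; rewrite fineK ?fin_num_measure//; exact: cdf_right_continuous.
have FNy : F @ -oo --> (0 : R) by exact/fine_cvg/cvg_cdfNy0.
have Fy : F @ +oo --> (1 : R) by exact/fine_cvg/cvg_cdfy1.
have mQ := measurable_quantile F_nd F_rc FNy Fy.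
exists (quantile F) => // A.
apply: (@probability_gt_unique R _ (measurableTypeR R) unif mu (quantile F)) => // x.
by rewrite [LHS]uniform_quantile// -setCitvl probability_setC//= FE.
Qed.

End inverse_transform.

(** * Existence of i.i.d. sequences *)

(* If [(Y, b)] has law [(law of Y) x P], then [Y], [Y \o b], [Y \o b \o b], ...
   is an i.i.d. sequence. *)
Section splitting.
Context d (T : measurableType d) (R : realType) (P : probability T R).
Variables (Y : T -> R) (b : T -> T).
Hypotheses (mY : measurable_fun setT Y) (mb : measurable_fun setT b).
Hypothesis Pb : forall A, measurable A -> P (b @^-1` A) = P A.
Hypothesis indYb : independent_pair P Y b.

Let X i := Y \o iter i b.

Lemma measurable_splitting i : measurable_fun setT (X i).
Proof.
apply: measurableT_comp => //.
by elim: i => [|i ih]; [exact: measurable_id|exact: (measurableT_comp mb ih)].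
Qed.

Let mX i A : measurable A -> measurable (X i @^-1` A).
Proof. by move=> mA; exact: measurable_preimageT (measurable_splitting i) mA. Qed.

Let preimage_X_succ i A : X i.+1 @^-1` A = b @^-1` (X i @^-1` A).
Proof. by apply/seteqP; split=> w; rewrite /X /= -iterSr. Qed.

Let splitting_marginal i A : measurable A -> P (X i @^-1` A) = P (Y @^-1` A).
Proof. by move=> mA; elim: i => // i <-; rewrite preimage_X_succ Pb//; exact: mX. Qed.

Let splitting_prefix n (B : nat -> set R) : (forall i, measurable (B i)) ->
  P (\bigcap_(i < n) (X i @^-1` B i)) = (\prod_(i < n) P (Y @^-1` B i))%E.
Proof.
elim: n B => [|n ih] B mB.
  by rewrite bigcap_mkord !big_ord0 probability_setT.
have mI : measurable (\bigcap_(i < n) (X i @^-1` B i.+1)).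
  by apply: bigcap_measurableType => i _; exact: mX.
rewrite big_ord_recl /= -(ih (fun i => B i.+1))// -(Pb mI) -indYb//.
congr (P _); apply/seteqP; split=> w /=.
  move=> h; split=> [|i ni]; first exact: (h 0%N).
  by have := h i.+1 ni; rewrite preimage_X_succ.
by move=> [w0 h] [|i] ni //; rewrite preimage_X_succ; exact: h.
Qed.

Lemma splitting_iid : iid P X.
Proof.
split=> [I B uI mB|n A mA]; last by rewrite !splitting_marginal.
have [n In] := subset_iota I.
pose B' i := if i \in I then B i else setT.
have mB' i : measurable (B' i) by rewrite /B'; case: ifP.
rewrite (_ : \bigcap_(i in _) _ = \bigcap_(i < n) (X i @^-1` B' i)); last first.
  apply/seteqP; split=> w /= h i /=; rewrite /B'.
    by move=> ni; case: ifPn => // iI; exact: h.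
  by move=> iI; have := h i; rewrite /B' iI; apply; have := In _ iI; rewrite mem_iota.
rewrite splitting_prefix// -(big_mkord xpredT (fun i => P (Y @^-1` B' i))).
rewrite (eq_bigr (fun i => if i \in I then P (Y @^-1` B i) else 1%E)); last first.
  by move=> i _; rewrite /B'; case: ifP => //; rewrite preimage_setT probability_setT.
rewrite -big_mkcond/= -big_filter (perm_big I).
  by apply: eq_bigr => i _; rewrite splitting_marginal.
apply: uniq_perm => // [|i]; first exact/filter_uniq/iota_uniq.
rewrite mem_filter /index_iota subn0.
by apply/andP/idP => [[]//|iI]; split => //; exact: In.
Qed.

End splitting.

Theorem exists_iid_sequence (R : realType) (mu : probability (measurableTypeR R) R) :
  exists (d : measure_display) (T : measurableType d) (P : probability T R)
    (X : nat -> {RV P >-> R}), iid P (fun i => X i : T -> R) /\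
    forall A, measurable A -> P (X 0%N @^-1` A) = mu A.
Proof.
have [Q mQ QE] := inverse_transform_sampling mu.
pose g : bit_sequence -> R := Q \o binary_value.
have mg : measurable_fun setT g by exact: measurableT_comp measurable_binary_value.
pose evens : bit_sequence -> bit_sequence := reindex double.
pose odds : bit_sequence -> bit_sequence := reindex (fun k => k.*2.+1).
have [mevens modds] := (measurable_reindex double, measurable_reindex (fun k => k.*2.+1)).
have oddK : cancel (fun k => k.*2.+1) half by by move=> k; rewrite /= uphalf_double.
pose Y := g \o evens.
have mY : measurable_fun setT Y by exact: measurableT_comp mevens.
have double_odd i j : i.*2 != j.*2.+1.
  by apply/eqP => /(congr1 odd); rewrite /= !odd_double.
have mgA A : measurable A -> measurable (g @^-1` A) by exact: measurable_preimageT.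
have ind : independent_pair (@coin R) Y odds.
  move=> A B /mgA mA mB; exact: (independent_reindex doubleK oddK double_odd mA mB).
have coin_odds A : measurable A -> coin (odds @^-1` A) = coin A :> \bar R.
  exact: coin_reindex oddK.
pose X i := Y \o iter i odds.
pose mX i : measurable_fun setT (X i) := measurable_splitting mY modds i.
pose X' i : {RV (@coin R) >-> R} := HB.pack (X i) (isMeasurableFun.Build _ _ _ _ (X i) (mX i)).
exists (sigma_display cylinders), bit_sequence, (@coin R), X'; split.
  exact: splitting_iid.
move=> A mA; rewrite [LHS](coin_reindex doubleK (mgA _ mA)) -QE//.
rewrite [LHS](uniform_prob01E true true); last first.
  exact: measurable_preimageT measurable_binary_digits (mgA _ mA).
rewrite (uniform_prob01E true true); last exact: measurable_preimageT mQ mA.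
congr (lebesgue_measure _); apply/seteqP; split=> x /= [+ x01];
  by rewrite /g /= binary_value_digits//; move: x01; rewrite in_itv.
Qed.

(** * Laws, densities and expectations *)

Section equal_laws.
Context d (T : measurableType d) (R : realType) (P : probability T R).
Variables X Y : {RV P >-> R}.
Hypothesis XY : forall A, measurable A -> P (X @^-1` A) = P (Y @^-1` A).

Let ge0_equal_laws (f : R -> \bar R) : measurable_fun setT f ->
  (forall x, 0 <= f x)%E -> (\int[P]_w f (X w) = \int[P]_w f (Y w))%E.
Proof.
move=> mf f0; rewrite -[LHS](ge0_integral_distribution X mf f0).
rewrite -[RHS](ge0_integral_distribution Y mf f0).
by apply: eq_measure_integral => A mA _; exact: XY.
Qed.

Lemma equal_laws_expectation (g : R -> R) : measurable_fun setT g ->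
  ('E_P[g \o X] = 'E_P[g \o Y])%E.
Proof.
move=> mg; have mEg : measurable_fun setT (EFin \o g) by exact/measurable_EFinP.
have posnegE (Z : {RV P >-> R}) : ('E_P[g \o Z] =
    \int[P]_w (EFin \o g)^\+ (Z w) - \int[P]_w (EFin \o g)^\- (Z w))%E.
  by rewrite unlock (integralE P setT ((EFin \o g) \o Z)) funepos_comp funeneg_comp.
rewrite !posnegE; congr (_ - _)%E; apply: ge0_equal_laws => //.
  exact: measurable_funepos.
exact: measurable_funeneg.
Qed.

End equal_laws.

Section symmetric_law.
Context d (T : measurableType d) (R : realType) (P : probability T R).

Definition symmetric_law (X : {RV P >-> R}) :=
  forall A, measurable A -> P (X @^-1` A) = P ((- X)%R @^-1` A).

Lemma symmetric_law_expectation (X : {RV P >-> R}) :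
  symmetric_law X -> (X : T -> R) \in Lfun P 1 -> ('E_P[X] = 0)%E.
Proof.
move=> symX X1; have /= := equal_laws_expectation symX (@measurable_id _ R setT).
have -> : ('E_P[idfun \o (- X)%R] = 'E_P[(-1 : R) \o* X])%E.
  by congr ('E_P[_])%E; apply/funext => w /=; rewrite mulrN1.
rewrite expectationZl// -(fineK (expectation_fin_num X1)) => -[/eqP].
by rewrite mulN1r -addr_eq0 -mulr2n mulrn_eq0 => /eqP ->.
Qed.

End symmetric_law.

Lemma ge0_integral_oppr (R : realType) (A : set R) (f : R -> \bar R) : measurable A ->
  measurable_fun setT f -> (forall x, 0 <= f x)%E ->
  (\int[lebesgue_measure]_(x in A) f x =
   \int[lebesgue_measure]_(x in -%R @^-1` A) f (- x)%R)%E.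
Proof.
move=> mA mf f0.
rewrite -(@ge0_integral_pushforward _ _ _ _ _
  (-%R : measurableTypeR R -> measurableTypeR R))//=.
- by apply: eq_measure_integral => //= B mB _; exact/esym/lebesgue_measureN.
- exact: measurable_funS mf.
Qed.

Lemma ge0_integral_density d (T : measurableType d) (R : realType)
    (mu : {sigma_finite_measure set T -> \bar R})
    (nu : {finite_measure set T -> \bar R}) (p : T -> R) :
  measurable_fun setT p -> (forall x, 0 <= p x) ->
  (forall A, measurable A -> nu A = (\int[mu]_(x in A) (p x)%:E)%E) ->
  forall f : T -> \bar R, measurable_fun setT f -> (forall x, 0 <= f x)%E ->
  (\int[nu]_x f x = \int[mu]_x (f x * (p x)%:E))%E.
Proof.
move=> mp p0 nuE f mf f0.
have ip : mu.-integrable setT (EFin \o p).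
  by apply: ge0_integrable => //; rewrite -nuE// -ge0_fin_numE// fin_num_measure.
have dom : nu `<< mu.
  apply/null_content_dominatesP => A mA muA; rewrite nuE//.
  apply: null_set_integral => //; apply: measurable_funTS; exact/measurable_EFinP.
rewrite -(Radon_Nikodym_SigmaFinite.change_of_variables dom)//.
have irn := Radon_Nikodym_SigmaFinite.f_integrable dom.
apply: ge0_ae_eq_integral => //.
- by apply: emeasurable_funM => //; exact: measurable_int irn.
- by apply: emeasurable_funM => //; exact/measurable_EFinP.
- by move=> x _; rewrite mule_ge0//; exact: Radon_Nikodym_SigmaFinite.f_ge0.
- by move=> x _; rewrite mule_ge0// lee_fin.
- apply: ae_eqe_mul2l; apply: integral_ae_eq => //; first exact/measurable_EFinP.
  move=> A _ mA; transitivity (nu A); last exact: nuE.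
  exact/esym/Radon_Nikodym_SigmaFinite.f_integral.
Qed.

Lemma integral_is_density d (T : measurableType d) (R : realType) (P : probability T R)
    (f : T -> R) (p : R -> R) :
  is_density P f p -> (\int[lebesgue_measure]_x (p x)%:E = 1)%E.
Proof. by move=> [_ _ <-//]; rewrite preimage_setT probability_setT. Qed.

Section density.
Context d (T : measurableType d) (R : realType) (P : probability T R).
Local Notation mu := (@lebesgue_measure R).
Variables (X : {RV P >-> R}) (p : R -> R).
Hypothesis Xp : is_density P X p.

Lemma ge0_expectation_density (g : R -> R) : measurable_fun setT g ->
  (forall x, 0 <= g x) -> ('E_P[g \o X] = \int[mu]_x (g x * p x)%:E)%E.
Proof.
move=> mg g0; have [mp p0 pE] := Xp.
have mEg : measurable_fun setT (EFin \o g) by exact/measurable_EFinP.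
have g0' x : (0 <= (EFin \o g) x)%E by rewrite lee_fin.
(* [lebesgue_measure] lives on [measurableTypeR R], whose measurable structure is
   convertible to that of [R] but has another display. *)
have mX : measurable_fun setT (X : T -> measurableTypeR R).
  exact: (measurable_funP X).
pose X' : {RV P >-> measurableTypeR R} :=
  HB.pack (X : T -> measurableTypeR R) (isMeasurableFun.Build _ _ _ _ _ mX).
rewrite unlock -[LHS](ge0_integral_distribution X' mEg g0').
exact: (@ge0_integral_density _ (measurableTypeR R) R mu (distribution P X') p).
Qed.

Lemma even_density_symmetric : (forall x, p (- x) = p x) ->
  symmetric_law X.
Proof.
move=> p_even A mA; have [mp p0 pE] := Xp.
have mNA : measurable (-%R @^-1` A) by exact: measurable_preimageT (@oppr_measurable _ _) mA.
rewrite -[(- X)%R @^-1` A]/(X @^-1` (-%R @^-1` A)) !pE//.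
rewrite [LHS]ge0_integral_oppr//; last exact/measurable_EFinP.
by under eq_integral do rewrite p_even.
Qed.

End density.

(** * Relative entropy bounds *)

(* The Young inequality for the convex conjugate pair [x ln x - x] and [expR]. *)
Lemma young_ln_expR (R : realType) (y z h : R) : 0 <= y -> 0 < z ->
  y * h + y - z * expR h <= y * ln (y / z).
Proof.
rewrite le_eqVlt => /predU1P[<-|y0] z0.
  by rewrite !mul0r !add0r oppr_le0 mulr_ge0// ?expR_ge0// ltW.
have yz : 0 < y / z by rewrite divr_gt0.
have : 1 + (h - ln (y / z)) <= expR (h - ln (y / z)) by exact: expR_ge1Dx.
rewrite expRD expRN lnK ?posrE// invf_div => /(ler_wpM2l (ltW y0)).
have -> : y * (expR h * (z / y)) = z * expR h by field; rewrite gt_eqF.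
lra.
Qed.

Lemma le_integral_measurable d (T : measurableType d) (R : realType)
    (m : {measure set T -> \bar R}) (D : set T) (f g : T -> \bar R) :
  measurable D -> measurable_fun D f -> measurable_fun D g ->
  (forall x, D x -> (f x <= g x)%E) ->
  (\int[m]_(x in D) f x <= \int[m]_(x in D) g x)%E.
Proof.
move=> mD mf mg fg; rewrite [leLHS]integralE [leRHS]integralE; apply: leeB.
  apply: ge0_le_integral => //; try exact: measurable_funepos.
  by move=> x Dx; rewrite !funeposE ge_max !le_max fg//= lexx orbT.
apply: ge0_le_integral => //; try exact: measurable_funeneg.
by move=> x Dx; rewrite !funenegE ge_max !le_max leeN2 fg//= lexx orbT.
Qed.

Section relative_entropy.
Context {R : realType}.
Local Notation mu := (@lebesgue_measure R).
Variables a sigma : R.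
Hypothesis sigma0 : sigma != 0.

Lemma normal_pdf_gt0 x : 0 < normal_pdf a sigma x.
Proof. by rewrite normal_pdfE// mulr_gt0 ?normal_peak_gt0 ?expR_gt0. Qed.

Lemma ln_normal_pdf x :
  ln (normal_pdf a sigma x) = ln (normal_peak sigma) - (x - a) ^+ 2 / (sigma ^+ 2 *+ 2).
Proof.
by rewrite normal_pdfE// lnM ?posrE ?normal_peak_gt0 ?expR_gt0// expRK mulNr.
Qed.

Section nonnegative_function.
Variable p : R -> R.
Hypotheses (mp : measurable_fun setT p) (p0 : forall x, 0 <= p x).

Lemma measurable_rel_entropy :
  measurable_fun setT (fun x => (p x * ln (p x / normal_pdf a sigma x))%:E).
Proof.
have cV : continuous (fun x => (normal_pdf a sigma x)^-1).
  by move=> x; apply: cvgV; [rewrite gt_eqF// normal_pdf_gt0|exact: continuous_normal_pdf].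
apply/measurable_EFinP; apply: measurable_funM => //.
apply: (measurableT_comp (@measurable_ln R)); apply: measurable_funM => //.
exact: continuous_measurable_fun.
Qed.

Lemma rel_entropy_normal_lty (M : R) : (forall x, p x <= M) ->
  (\int[mu]_x (p x)%:E < +oo)%E -> (\int[mu]_x ((x - a) ^+ 2 * p x)%:E < +oo)%E ->
  (rel_entropy_normal p a sigma < +oo)%E.
Proof.
move=> pM p1 p2; pose K := `|ln M - ln (normal_peak sigma)|.
have K0 : 0 <= K by exact: normr_ge0.
pose c := (sigma ^+ 2 *+ 2)^-1.
have c0 : 0 <= c by rewrite invr_ge0 mulrn_wge0// sqr_ge0.
have msq : measurable_fun setT (fun x : R => (x - a) ^+ 2).
  by apply: measurable_funX; exact: measurable_funB.
have mp' : measurable_fun setT (fun x : R => (p x)%:E) by exact/measurable_EFinP.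
have mp2 : measurable_fun setT (fun x : R => ((x - a) ^+ 2 * p x)%:E).
  by apply/measurable_EFinP; exact: measurable_funM.
have p20 x : (0 <= ((x - a) ^+ 2 * p x)%:E)%E by rewrite lee_fin mulr_ge0// sqr_ge0.
apply: (@le_lt_trans _ _
    (\int[mu]_x (K%:E * (p x)%:E + c%:E * ((x - a) ^+ 2 * p x)%:E))%E).
  apply: le_integral_measurable => //.
  - exact: measurable_rel_entropy.
  - by apply: emeasurable_funD; exact: emeasurable_funM.
  - move=> x _; rewrite -!EFinM -EFinD lee_fin.
    have := p0 x; rewrite le_eqVlt => /predU1P[<-|px]; first by rewrite !(mul0r, mulr0) addr0.
    rewrite ln_div ?posrE ?normal_pdf_gt0// ln_normal_pdf -/c.
    rewrite (_ : K * _ + _ = p x * (K + (x - a) ^+ 2 * c)); last by ring.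
    rewrite ler_pM2l//.
    have : ln (p x) <= ln M by rewrite ler_ln ?posrE// (lt_le_trans px).
    by have := ler_norm (ln M - ln (normal_peak sigma)); rewrite -/K; lra.
rewrite ge0_integralD//; last 4 first.
- by move=> x _; rewrite mule_ge0 ?lee_fin.
- exact: emeasurable_funM.
- by move=> x _; rewrite mule_ge0.
- exact: emeasurable_funM.
rewrite !ge0_integralZl ?lee_fin//; last by move=> x _; rewrite lee_fin.
by rewrite lte_add_pinfty// lte_mul_pinfty// lee_fin.
Qed.

(* The variational formula for relative entropy, tested on [L * \1_A]. *)
Lemma rel_entropy_normal_ge (A : set R) (L : R) : measurable A ->
  (\int[mu]_x (p x)%:E = 1)%E ->
  (L%:E * \int[mu]_(x in A) (p x)%:E - (expR L)%:E * normal_prob a sigma A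
     <= rel_entropy_normal p a sigma)%E.
Proof.
move=> mA p1; pose phi := normal_pdf a sigma.
have ip : mu.-integrable setT (EFin \o p) by apply: ge0_integrable => //; rewrite p1 ltry.
have iphi : mu.-integrable setT (EFin \o phi) by exact: integrable_normal_pdf.
pose u x := (L%:E * (p x)%:E - (expR L)%:E * (phi x)%:E)%E.
have iu : mu.-integrable setT u by apply: integrableB => //; exact: integrableZl.
have iuA : mu.-integrable setT (u \_ A).
  by apply/integrable_restrict => //=; rewrite setTI; exact: integrableS iu.
have intu : (\int[mu]_(x in A) u x =
    L%:E * \int[mu]_(x in A) (p x)%:E - (expR L)%:E * normal_prob a sigma A)%E.
  rewrite integralB//; last 2 first.
  - by apply: integrableZl => //; exact: integrableS ip.
  - by apply: integrableZl => //; exact: integrableS iphi.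
  by rewrite !integralZl//; [exact: integrableS iphi|exact: integrableS ip].
have ipphi : mu.-integrable setT (fun x => (p x)%:E - (phi x)%:E)%E by exact: integrableB.
have intpphi : (\int[mu]_x ((p x)%:E - (phi x)%:E) = 0)%E.
  by rewrite integralB// p1 integral_normal_pdf subee.
rewrite -intu integral_mkcond -[leLHS]adde0 -intpphi -integralD//.
apply: le_integral_measurable => //.
- by apply: emeasurable_funD; [exact: measurable_int iuA|exact: measurable_int ipphi].
- exact: measurable_rel_entropy.
move=> x _; rewrite patchE; have := normal_pdf_gt0 x; rewrite -/(phi x) => phi0.
case: ifPn => _; rewrite /u -?EFinM -?EFinB ?add0e -?EFinD lee_fin.
  by have := young_ln_expR L (p0 x) phi0; have := ltW phi0; lra.
by have := young_ln_expR 0 (p0 x) phi0; rewrite mulr0 add0r expR0 mulr1.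
Qed.

End nonnegative_function.

Lemma normal_pdf_le_wider (r x : R) : 0 <= r -> r <= `|x - a| ->
  normal_pdf a sigma x <= Num.sqrt 2 * expR (- r ^+ 2 / (sigma ^+ 2 *+ 4)) *
    normal_pdf a (Num.sqrt 2 * sigma) x.
Proof.
move=> r0 rx; have s20 : Num.sqrt 2 * sigma != 0 by rewrite mulf_neq0// gt_eqF// sqrtr_gt0.
have wide2 : (Num.sqrt 2 * sigma) ^+ 2 = sigma ^+ 2 *+ 2.
  by rewrite exprMn sqr_sqrtr// mulr_natl.
have peakE : normal_peak sigma = Num.sqrt 2 * normal_peak (Num.sqrt 2 * sigma).
  rewrite /normal_peak wide2 (_ : _ *+ 2 * pi *+ 2 = 2 * (sigma ^+ 2 * pi *+ 2)).
    by rewrite [in RHS]sqrtrM// invfM mulVKf// gt_eqF// sqrtr_gt0.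
  by ring.
rewrite normal_pdfE// normal_pdfE// /normal_fun peakE [leRHS]mulrACA.
apply: ler_wpM2l; first by rewrite mulr_ge0// normal_peak_ge0.
rewrite -expRD ler_expR wide2 -mulrnA -mulrDl.
have r2x2 : r ^+ 2 <= (x - a) ^+ 2.
  by rewrite -[leRHS](real_normK (num_real _)) ler_sqr ?nnegrE.
have -> : - (x - a) ^+ 2 / (sigma ^+ 2 *+ 2) = - ((x - a) ^+ 2 *+ 2) / (sigma ^+ 2 *+ 4).
  by field.
by rewrite ler_pM2r ?invr_gt0 ?pmulrn_lgt0 ?exprn_even_gt0//; lra.
Qed.

Lemma normal_prob_tail (r : R) : 0 <= r ->
  (normal_prob a sigma [set x | (r < `|x - a|)%R] <=
   (Num.sqrt 2 * expR (- r ^+ 2 / (sigma ^+ 2 *+ 4)))%:E)%E.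
Proof.
move=> r0; set A := [set x | _]; set K := Num.sqrt 2 * _.
have mA : measurable A.
  apply: measurable_set_ltr => //; apply: measurableT_comp => //.
  exact: measurable_funB.
have s20 : Num.sqrt 2 * sigma != 0 by rewrite mulf_neq0// gt_eqF// sqrtr_gt0.
have K0 : 0 <= K by rewrite mulr_ge0// expR_ge0.
pose wide x := (normal_pdf a (Num.sqrt 2 * sigma) x)%:E.
have mwide D : measurable_fun D (fun x => K%:E * wide x)%E.
  apply: measurable_funTS; apply: emeasurable_funM => //.
  by apply/measurable_EFinP; exact: measurable_normal_pdf.
have wide0 x : (0 <= K%:E * wide x)%E.
  by rewrite mule_ge0// lee_fin// normal_pdf_ge0.
apply: (@le_trans _ _ (\int[mu]_x (K%:E * wide x))%E); last first.
  by rewrite integralZl// ?integral_normal_pdf ?mule1//; exact: integrable_normal_pdf.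
apply: (@le_trans _ _ (\int[mu]_(x in A) (K%:E * wide x))%E); last first.
  by apply: ge0_subset_integral => //; exact: mwide.
apply: ge0_le_integral => //.
- by move=> x _; rewrite lee_fin normal_pdf_ge0.
- by apply: measurable_funTS; apply/measurable_EFinP; exact: measurable_normal_pdf.
- exact: mwide.
by move=> x /= /ltW rx; rewrite -EFinM lee_fin normal_pdf_le_wider.
Qed.

End relative_entropy.

Lemma expectation_sqr_Lfun2 d (T : measurableType d) (R : realType)
    (P : probability T R) (X : {RV P >-> R}) :
  ('E_P[fun w => (X w ^+ 2)%R] < +oo)%E -> (X : T -> R) \in Lfun P 2%:E.
Proof.
rewrite unlock => X2; rewrite inE/=; apply/andP; split; rewrite inE/=.
  exact: measurable_funP.
rewrite /finite_norm unlock /Lnorm; apply: poweR_lty.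
rewrite (eq_integral (fun w => (X w ^+ 2)%:E))// => w _.
by rewrite /= powR_mulrn// real_normK ?num_real.
Qed.

Lemma even_density_moments d (T : measurableType d) (R : realType)
    (P : probability T R) (X : {RV P >-> R}) (p : R -> R) (v : R) :
  is_density P X p -> (forall x, p (- x) = p x) ->
  (\int[lebesgue_measure]_x (x ^+ 2 * p x)%:E = v%:E)%E ->
  [/\ (X : T -> R) \in Lfun P 2%:E, 'E_P[X] = 0, 'E_P[fun w => (X w ^+ 2)%R] = v%:E &
    'V_P[X] = v%:E]%E.
Proof.
move=> Xp p_even p2.
have EX2 : ('E_P[fun w => (X w ^+ 2)%R] = v%:E)%E.
  by rewrite -p2 -(ge0_expectation_density Xp (exprn_measurable 2))// => x; exact: sqr_ge0.
have X2 : (X : T -> R) \in Lfun P 2%:E by rewrite expectation_sqr_Lfun2// EX2 ltry.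
have EX : ('E_P[X] = 0)%E.
  apply: symmetric_law_expectation (even_density_symmetric Xp p_even) _.
  by apply: Lfun_subset12 X2; exact: fin_num_measure.
by split=> //; rewrite varianceE// EX expe2 mule0 sube0 -EX2.
Qed.

Section entropy_of_law.
Context d (T : measurableType d) (R : realType) (P : probability T R).
Variables (a sigma : R).
Hypothesis sigma0 : 0 < sigma.

Lemma D_normalE (f : T -> R) : ('E_P[f] = a%:E)%E -> ('V_P[f] = (sigma ^+ 2)%:E)%E ->
  D P f = ereal_inf [set rel_entropy_normal p a sigma | p in is_density P f].
Proof. by move=> Ef Vf; rewrite /D Ef Vf /= sqrtr_sqr gtr0_norm. Qed.

Lemma D_bounded_density_lty (X : {RV P >-> R}) (p : R -> R) (M : R) :
  ('E_P[X] = a%:E)%E -> ('V_P[X] = (sigma ^+ 2)%:E)%E ->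
  is_density P X p -> (forall x, p x <= M) -> (D P X < +oo)%E.
Proof.
move=> EX VX Xp pM; have [mp p0 _] := Xp.
rewrite D_normalE//; apply: (@le_lt_trans _ _ (rel_entropy_normal p a sigma)).
  by apply: ereal_inf_lbound; exists p.
apply: rel_entropy_normal_lty pM _ _ => //; first by rewrite gt_eqF.
  by rewrite (integral_is_density Xp) ltry.
have msq : measurable_fun setT (fun x : R => (x - a) ^+ 2).
  by apply: measurable_funX; exact: measurable_funB.
rewrite -(ge0_expectation_density Xp msq) => [|x]; last exact: sqr_ge0.
move: VX; rewrite /variance covariance.unlock EX => VX.
by rewrite [X in (X < _)%E]VX ltry.
Qed.

Lemma D_ge_tail (f : T -> R) (L r : R) :
  ('E_P[f] = a%:E)%E -> ('V_P[f] = (sigma ^+ 2)%:E)%E -> 0 <= r ->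
  (L%:E * P [set w | (r < `|f w - a|)%R] -
    (Num.sqrt 2 * expR (L - r ^+ 2 / (sigma ^+ 2 *+ 4)))%:E <= D P f)%E.
Proof.
move=> Ef Vf r0; rewrite D_normalE//; apply: le_ereal_inf_tmp => _ [p fp <-].
have [[mp p0 pE] p1] := (fp, integral_is_density fp).
have sigmaN0 : sigma != 0 by rewrite gt_eqF.
have mA : measurable [set x : R | r < `|x - a|].
  by apply: measurable_set_ltr => //; apply: measurableT_comp => //; exact: measurable_funB.
apply: le_trans (rel_entropy_normal_ge a sigmaN0 mp p0 L mA p1).
rewrite -pE// leeB// expRD mulrCA EFinM lee_pmul2l ?lte_fin ?expR_gt0//.
by rewrite -mulNr; exact: normal_prob_tail.
Qed.

End entropy_of_law.

(** * Sums of i.i.d. variables *)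

Section uncorrelated.
Context d (T : measurableType d) (R : realType) (P : probability T R).
Local Open Scope ereal_scope.

Let P_fin : P setT \is a fin_num := fin_num_measure P _ measurableT.

Lemma covariance_suml (X : nat -> T -> R) (Y : T -> R) n :
  (forall i, X i \in Lfun P 2%:E) -> Y \in Lfun P 2%:E ->
  covariance P (\sum_(i < n) X i)%R Y = \sum_(i < n) covariance P (X i) Y.
Proof.
move=> X2 Y2; have X1 i := Lfun_subset12 P_fin (X2 i).
have Y1 := Lfun_subset12 P_fin Y2.
elim: n => [|n ih]; first by rewrite !big_ord0 covariance_cst_l.
have S2 : (\sum_(i < n) X i)%R \in Lfun P 2%:E by rewrite rpred_sum ?lee1n.
by rewrite !big_ord_recr/= covarianceDl ?ih// ?Lfun2_mul_Lfun1.
Qed.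

Lemma variance_sum_uncorrelated (X : nat -> T -> R) n :
  (forall i, X i \in Lfun P 2%:E) ->
  (forall i j, i != j -> covariance P (X i) (X j) = 0) ->
  'V_P[(\sum_(i < n) X i)%R] = \sum_(i < n) 'V_P[X i].
Proof.
move=> X2 covX; elim: n => [|n ih]; first by rewrite !big_ord0 variance_cst.
have S2 : (\sum_(i < n) X i)%R \in Lfun P 2%:E by rewrite rpred_sum ?lee1n.
rewrite !big_ord_recr/= varianceD// ih covariance_suml// [X in _ * X]big1.
  by rewrite mule0 adde0.
by move=> i _; rewrite covX// ltn_eqF.
Qed.

End uncorrelated.

Section independent_product.
Context d (T : measurableType d) (R : realType) (P : probability T R).
Variables X Y : {RV P >-> R}.
Hypothesis indXY : independent_pair P X Y.
Local Open Scope ereal_scope.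

Let XY w := (X w, Y w).

Let mXY : measurable_fun setT XY.
Proof. exact/measurable_fun_pair. Qed.

Let law_XY (A : set (R * R)) : measurable A ->
  (distribution P X \x distribution P Y) A = P (XY @^-1` A).
Proof.
pose m : {measure set (R * R) -> \bar R} := pushforward P XY.
by apply: (@product_measure_unique _ _ _ _ _ _ _ (m mXY)) => B C mB mC; exact: indXY.
Qed.

Lemma independent_expectationM : (X : T -> R) \in Lfun P 1 -> (Y : T -> R) \in Lfun P 1 ->
  ((X : T -> R) * Y)%R \in Lfun P 1 ->
  'E_P[((X : T -> R) * Y)%R] = 'E_P[X] * 'E_P[Y].
Proof.
move=> X1 Y1 XY1; pose f (z : R * R) := (z.1 * z.2)%:E.
have mf : measurable_fun setT f.
  by apply/measurable_EFinP; apply: measurable_funM; [exact: measurable_fst|exact: measurable_snd].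
have ifXY : P.-integrable setT (f \o XY) by exact/Lfun1_integrable.
have eq_law : \int[distribution P X \x distribution P Y]_z f z = \int[P]_w (X w * Y w)%:E.
  rewrite -[RHS](integral_pushforward mXY mf ifXY measurableT).
  by apply: eq_measure_integral => A mA _; exact: law_XY.
have if_ : (distribution P X \x distribution P Y).-integrable setT f.
  have /integrableP[_ fy] := integrable_pushforward mXY mf ifXY measurableT.
  apply/integrableP; split=> //; rewrite (eq_measure_integral (pushforward P XY))//.
  by move=> A mA _; exact: law_XY.
have iY : (distribution P Y).-integrable setT EFin.
  by apply: integrable_pushforward => //; exact/Lfun1_integrable.
have iX : (distribution P X).-integrable setT EFin.
  by apply: integrable_pushforward => //; exact/Lfun1_integrable.
rewrite unlock -[LHS]eq_law -integral12_prod_meas1//.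
transitivity (\int[distribution P X]_x (x%:E * \int[distribution P Y]_y y%:E)).
  apply: eq_integral => x _; rewrite /fubini_F /f/=.
  by under eq_integral do rewrite EFinM; rewrite integralZl.
have iYfin : (\int[distribution P Y]_y y%:E) \is a fin_num by exact: integrable_fin_num.
rewrite -(fineK iYfin) integralZr// (fineK iYfin); congr (_ * _).
  by rewrite (@integral_distribution _ _ _ _ _ P X EFin)//; exact/Lfun1_integrable.
by rewrite (@integral_distribution _ _ _ _ _ P Y EFin)//; exact/Lfun1_integrable.
Qed.

Lemma independent_covariance : (X : T -> R) \in Lfun P 2%:E -> (Y : T -> R) \in Lfun P 2%:E ->
  covariance P X Y = 0.
Proof.
move=> X2 Y2; have P_fin : P setT \is a fin_num := fin_num_measure P _ measurableT.
have [X1 Y1] := (Lfun_subset12 P_fin X2, Lfun_subset12 P_fin Y2).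
have XY1 := Lfun2_mul_Lfun1 X2 Y2.
rewrite covarianceE// independent_expectationM// subee// fin_numM//;
  exact: expectation_fin_num.
Qed.

End independent_product.

Lemma mutually_independent_pair d (T : measurableType d) (R : realType)
    (P : probability T R) (X : nat -> T -> R) i j :
  mutually_independent P X -> i != j -> independent_pair P (X i) (X j).
Proof.
move=> indX ij A B mA mB; pose C k := if k == i then A else B.
have Ci : C i = A by rewrite /C eqxx.
have Cj : C j = B by rewrite /C eq_sym (negbTE ij).
have mC k : measurable (C k) by rewrite /C; case: ifP.
have uij : uniq [:: i; j] by rewrite /= inE ij.
have := indX [:: i; j] C uij mC; rewrite !big_cons big_nil mule1 Ci Cj => <-.
congr (P _); apply/seteqP; split=> w /=.
  by move=> [wA wB] k /=; rewrite !inE => /orP[/eqP->|/eqP->]; rewrite ?Ci ?Cj.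
by move=> wC; split; [have := wC i|have := wC j];
  rewrite ?Ci ?Cj; apply; rewrite /= !inE eqxx ?orbT.
Qed.

Section iid_sum.
Context d (T : measurableType d) (R : realType) (P : probability T R).
Variable X : nat -> {RV P >-> R}.
Hypothesis iidX : iid P (fun i => X i : T -> R).
Hypothesis X2 : (X 0%N : T -> R) \in Lfun P 2%:E.
Local Open Scope ereal_scope.

Let P_fin : P setT \is a fin_num := fin_num_measure P _ measurableT.

Let iid_law i A : measurable A -> P (X i @^-1` A) = P (X 0%N @^-1` A).
Proof. exact: iidX.2. Qed.

Lemma iid_expectation i : 'E_P[X i] = 'E_P[X 0%N].
Proof. exact: (equal_laws_expectation (iid_law i) (@measurable_id _ R setT)). Qed.

Lemma iid_Lfun2 i : (X i : T -> R) \in Lfun P 2%:E.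
Proof.
apply: expectation_sqr_Lfun2.
have msq : measurable_fun setT (fun x : R => (x ^+ 2)%R) by exact: exprn_measurable.
rewrite [X in X < _](equal_laws_expectation (iid_law i) msq).
have := expectation_fin_num (Lfun2_mul_Lfun1 X2 X2).
by rewrite fin_numElt => /andP[].
Qed.

Lemma iid_variance i : 'V_P[X i] = 'V_P[X 0%N].
Proof.
rewrite !varianceE ?iid_Lfun2// iid_expectation; congr (_ - _).
exact: (equal_laws_expectation (iid_law i) (exprn_measurable 2)).
Qed.

Let iid_sum_Lfun2 n : (\sum_(i < n) (X i : T -> R))%R \in Lfun P 2%:E.
Proof. by have Xi2 := iid_Lfun2; rewrite rpred_sum ?lee1n. Qed.

Let normalized_sumE n : normalized_sum (fun i => X i : T -> R) n =
  ((Num.sqrt n%:R)^-1 \o* (\sum_(i < n) (X i : T -> R)))%R.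
Proof. by apply/funext => w; rewrite /normalized_sum fct_sumE. Qed.

Lemma normalized_sum_expectation n : 'E_P[X 0%N] = 0 ->
  'E_P[normalized_sum (fun i => X i : T -> R) n] = 0.
Proof.
move=> EX; have S1 := Lfun_subset12 P_fin (iid_sum_Lfun2 n).
rewrite normalized_sumE expectationZl//.
rewrite -(big_map (fun i : 'I_n => X i : T -> R) xpredT id) expectation_sum.
  by rewrite big_map big1 ?mule0// => i _; rewrite iid_expectation.
by move=> Y /mapP[i _ ->]; exact: Lfun_subset12 (iid_Lfun2 i).
Qed.

Lemma normalized_sum_variance n : (0 < n)%N ->
  'V_P[normalized_sum (fun i => X i : T -> R) n] = 'V_P[X 0%N].
Proof.
move=> n0; have covX i j : i != j -> covariance P (X i) (X j) = 0.
  move=> ij; apply: independent_covariance; [|exact: iid_Lfun2|exact: iid_Lfun2].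
  exact: mutually_independent_pair iidX.1 ij.
rewrite normalized_sumE varianceZ//.
rewrite (@variance_sum_uncorrelated _ _ _ _ (fun i => X i)) //; last exact: iid_Lfun2.
rewrite (eq_bigr (fun=> 'V_P[X 0%N])) => [|i _]; last exact: iid_variance.
rewrite -(fineK (variance_fin_num X2)) sumEFin sumr_const card_ord -EFinM.
by rewrite exprVn sqr_sqrtr// -(mulr_natl (fine _)) mulKf// pnatr_eq0 -lt0n.
Qed.

End iid_sum.

(** * The single big jump bound *)

Section joint_events.
Context d (T : measurableType d) (R : realType) (P : probability T R).
Variable X : nat -> {RV P >-> R}.
Implicit Type J : seq nat.
Local Open Scope ereal_scope.

Definition joint_events J : set (set T) :=
  [set C | exists2 B : nat -> set R, (forall j, measurable (B j)) &
     C = \bigcap_(j in [set` J]) (X j @^-1` B j)].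

Definition joint_type J := g_sigma_algebraType (joint_events J).

HB.instance Definition _ J := Measurable.on (joint_type J).

Lemma setI_closed_joint_events J : setI_closed (joint_events J).
Proof.
move=> _ _ [B mB ->] [C mC ->]; exists (fun j => B j `&` C j) => [j|].
  exact: measurableI.
by rewrite -bigcapI.
Qed.

Lemma measurable_joint J : @measurable _ (joint_type J) `<=` @measurable _ T.
Proof.
apply: smallest_sub; first exact: sigma_algebra_measurable.
by move=> _ [B mB ->]; apply: bigcap_measurableType => j _; exact: measurable_funPTI.
Qed.

Lemma measurable_joint_coordinate J j : j \in J ->
  measurable_fun [set: joint_type J] (X j : T -> R).
Proof.
move=> jJ _ A mA; rewrite setTI; apply: sub_sigma_algebra.
exists (fun k => if k == j then A else setT) => [k|]; first by case: ifP.
apply/seteqP; split=> w /= h; first by move=> k kJ /=; case: eqP => // ->.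
by have := h j jJ; rewrite /= eqxx.
Qed.

Hypothesis indX : mutually_independent P (fun i => X i : T -> R).

Lemma independent_joint_events i J A C : uniq (i :: J) -> measurable A ->
  @measurable _ (joint_type J) C ->
  P (X i @^-1` A `&` C) = P (X i @^-1` A) * P C.
Proof.
move=> uiJ mA sC; have /andP[iJ uJ] := uiJ.
pose id_joint : T -> joint_type J := id.
have mid : measurable_fun setT id_joint.
  by move=> _ B sB; rewrite setTI; exact: measurable_joint sB.
apply: (@independent_event_g_sigma _ _ _ _ _ (joint_type J) id_joint (joint_events J)) => //.
- exact: setI_closed_joint_events.
- exact: measurable_funPTI.
move=> _ [B mB ->]; rewrite preimage_id; pose B' k := if k == i then A else B k.
have mB' k : measurable (B' k) by rewrite /B'; case: ifP.
have B'J k : k \in J -> B' k = B k.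
  by move=> kJ; rewrite /B'; case: eqP => // ki; rewrite -ki kJ in iJ.
transitivity (P (\bigcap_(j in [set` i :: J]) (X j @^-1` B' j))).
  have -> : [set` i :: J] = i |` [set` J].
    by apply/seteqP; split=> j /=; rewrite inE => /predU1P.
  rewrite bigcap_setU1 {1}/B' eqxx; congr (P (_ `&` _)).
  by apply: eq_bigcapr => j jJ; rewrite B'J.
rewrite indX// big_cons {1}/B' eqxx; congr (_ * _).
rewrite (eq_big_seq (fun j => P (X j @^-1` B j))); last by move=> j /B'J ->.
by rewrite -indX.
Qed.

End joint_events.

Section big_jump.
Context d (T : measurableType d) (R : realType) (P : probability T R).
Variable X : nat -> {RV P >-> R}.
Variables (t q : R) (n : nat).
Hypothesis indX : mutually_independent P (fun i => X i : T -> R).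
Hypothesis t0 : 0 <= t.
Hypothesis tail_up : forall i, P [set w | t < X i w] = q%:E.
Hypothesis tail_down : forall i, P [set w | X i w < - t] = q%:E.
Local Open Scope ereal_scope.

Let others (i : nat) := [seq j <- iota 0 n | j != i].

Let other_sum i w := (\sum_(j <- others i) X j w)%R.

Let no_other_jump i := \bigcap_(j in [set` others i]) [set w | (`|X j w| <= t)%R].

Let jump_up i := [set w | (t < X i w)%R] `&`
  (no_other_jump i `&` [set w | (0 <= other_sum i w)%R]).

Let jump_down i := [set w | (X i w < - t)%R] `&`
  (no_other_jump i `&` [set w | (other_sum i w <= 0)%R]).

Let single_jump i := jump_up i `|` jump_down i.

Local Notation joint_measurable i := (@measurable _ (joint_type X (others i))).

Let uniq_others i : uniq (i :: others i).
Proof. by rewrite /= mem_filter eqxx/= filter_uniq// iota_uniq. Qed.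

Let q0 : (0 <= q)%R.
Proof. by rewrite -lee_fin -(tail_up 0). Qed.

Let measurable_upper_tail i : measurable [set w | (t < X i w)%R].
Proof. exact: measurable_set_ltr. Qed.

Let measurable_lower_tail i : measurable [set w | (X i w < - t)%R].
Proof. exact: measurable_set_ltr. Qed.

Let measurable_abs_tail i : measurable [set w | (t < `|X i w|)%R].
Proof. by apply: measurable_set_ltr => //; exact: measurableT_comp. Qed.

Let abs_tail i : P [set w | (t < `|X i w|)%R] <= (2 * q)%:E.
Proof.
rewrite (_ : [set w | _] = [set w | (t < X i w)%R] `|` [set w | (X i w < - t)%R]).
  rewrite (le_trans (measureU2 _ _ _))//.
  by rewrite [X in X + _]tail_up [X in _ + X]tail_down -EFinD mulr_natl mulr2n.
by apply/seteqP; split=> w /=; rewrite ltr_normr ltrNr => /orP.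
Qed.

Let joint_no_other_jump i : joint_measurable i (no_other_jump i).
Proof.
rewrite /no_other_jump bigcap_mkcond; apply: bigcap_measurableType => j _.
case: ifPn => [|_]; last exact: measurableT.
rewrite inE /= => jr; apply: measurable_set_ler => //.
by apply: measurableT_comp => //; exact: measurable_joint_coordinate.
Qed.

Let measurable_other_sum i :
  measurable_fun [set: joint_type X (others i)] (other_sum i).
Proof.
rewrite (_ : other_sum i = (fun w => \sum_(j <- others i)
    (if j \in others i then X j w else 0))%R).
  apply: measurable_sum => j; have [jr|_] := boolP (j \in others i); last exact: measurable_cst.
  exact: measurable_joint_coordinate.
by apply/funext => w; rewrite /other_sum big_seq big_mkcond.
Qed.

Let joint_up i : joint_measurable i
  (no_other_jump i `&` [set w | (0 <= other_sum i w)%R]).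
Proof.
apply: (@measurableI _ (joint_type X (others i)) (no_other_jump i)).
  exact: joint_no_other_jump.
by apply: measurable_set_ler; [|exact: measurable_other_sum].
Qed.

Let joint_down i : joint_measurable i
  (no_other_jump i `&` [set w | (other_sum i w <= 0)%R]).
Proof.
apply: (@measurableI _ (joint_type X (others i)) (no_other_jump i)).
  exact: joint_no_other_jump.
by apply: measurable_set_ler; [exact: measurable_other_sum|].
Qed.

Let measurable_jump_up i : measurable (jump_up i).
Proof. by apply: measurableI => //; exact: measurable_joint (@joint_up i). Qed.

Let measurable_jump_down i : measurable (jump_down i).
Proof. by apply: measurableI => //; exact: measurable_joint (@joint_down i). Qed.

Let measurable_single_jump i : measurable (single_jump i).
Proof. exact: measurableU. Qed.

Let no_other_jump_ge i : (1 - n%:R * (2 * q))%:E <= P (no_other_jump i).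
Proof.
have mM := measurable_joint (@joint_no_other_jump i).
rewrite EFinB leeBlDr// -leeBlDl; last by rewrite fin_num_measure.
rewrite -probability_setC//.
apply: (@le_trans _ _ (P (\big[setU/set0]_(j < n) [set w | (t < `|X j w|)%R]))).
  rewrite le_measure ?inE//; first exact: measurableC.
    exact: bigsetU_measurable.
  move=> w; rewrite /no_other_jump /setC /= => /existsNP[j /not_implyP[+ /negP]].
  rewrite -ltNge /= mem_filter mem_iota /= => /andP[_ jn] tj.
  by rewrite -(bigcup_mkord n (fun j => [set w | (t < `|X j w|)%R])); exists j.
apply: (le_trans (@Boole_inequality _ _ _ P (fun j => [set w | (t < `|X j w|)%R]) n _)) => //.
apply: (@le_trans _ _ (\sum_(j < n) (2 * q)%:E)).
  by apply: lee_sum => j _; exact: abs_tail.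
by rewrite sumEFin lee_fin sumr_const card_ord -[leLHS]mulr_natl.
Qed.

(* One of the two conditions on the sign of [other_sum] holds, so that
   independence gives [P (no_other_jump i)] after adding the two cases. *)
Let single_jump_ge i : (q * (1 - n%:R * (2 * q)))%:E <= P (single_jump i).
Proof.
have up_down0 : jump_up i `&` jump_down i = set0.
  by rewrite -subset0 => w [[/= h _] [/= h' _]]; move: t0; lra.
rewrite measureU// EFinM /jump_up /jump_down -preimage_itvoy -preimage_itvNyo.
rewrite [X in X + _](independent_joint_events indX (uniq_others i) _ (@joint_up i))//.
rewrite [X in _ + X](independent_joint_events indX (uniq_others i) _ (@joint_down i))//.
rewrite preimage_itvoy preimage_itvNyo [X in X * _ + _]tail_up [X in _ + X * _]tail_down.
rewrite -ge0_muleDr// lee_wpmul2l ?lee_fin//; apply: le_trans (no_other_jump_ge i) _.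
apply: le_trans (measureU2 _ _ _); [|exact: measurable_joint (@joint_up i)|
  exact: measurable_joint (@joint_down i)].
rewrite -setIUr (_ : _ `|` _ = setT) ?setIT//.
by apply/seteqP; split=> w //= _; apply/orP; exact: le_total.
Qed.

Let trivIset_single_jump : trivIset setT (fun i : 'I_n => single_jump i).
Proof.
apply/trivIsetP => i j _ _ ij; rewrite -subset0 => w /= [jump_i jump_j].
have big (k : 'I_n) : single_jump k w -> (t < `|X k w|)%R.
  by rewrite ltr_normr ltrNr => -[[/= ->]|[/= ->]]; rewrite ?orbT.
have : no_other_jump i w by case: jump_i => -[_ []].
have ji : (j != i :> nat)%N by rewrite -val_eqE/= eq_sym in ij.
move=> /(_ (nat_of_ord j)); rewrite /= mem_filter mem_iota /= ltn_ord ji => /(_ isT).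
by rewrite leNgt big.
Qed.

Let single_jump_sum i : (i < n)%N ->
  single_jump i `<=` [set w | (t < `|\sum_(j < n) X j w|)%R].
Proof.
move=> ni w jump_i /=.
have -> : (\sum_(j < n) X j w = X i w + other_sum i w)%R.
  rewrite -(big_mkord xpredT (fun j => X j w)) /other_sum big_filter.
  by rewrite /index_iota subn0 (bigD1_seq i)//= ?iota_uniq// mem_iota.
by rewrite ltr_normr; case: jump_i => -[/= h [_ /= h']]; apply/orP; [left|right]; lra.
Qed.

(* The events "only [X i] exceeds [t] in absolute value, and the sum of the others
   has weakly the sign of [X i]" are disjoint, and each of them forces the sum
   to exceed [t]. *)
Lemma big_jump : (n%:R * (q * (1 - n%:R * (2 * q))))%:E <=
  P [set w | (t < `|\sum_(i < n) X i w|)%R].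
Proof.
apply: (@le_trans _ _ (P (\big[setU/set0]_(i < n) single_jump i))).
  rewrite measure_bigsetU_ord//.
  apply: (@le_trans _ _ (\sum_(i < n) (q * (1 - n%:R * (2 * q)))%:E)).
    by rewrite sumEFin lee_fin sumr_const card_ord -[leRHS]mulr_natl.
  by apply: lee_sum => i _; exact: single_jump_ge.
rewrite le_measure ?inE//.
- exact: bigsetU_measurable.
- apply: measurable_set_ltr => //; apply: measurableT_comp => //.
  exact: measurable_sum.
by rewrite -(bigcup_mkord n single_jump) => w [i /= ni]; exact: single_jump_sum.
Qed.

End big_jump.

(** * A density with a heavy tail *)

Lemma exists_probability_density d (T : measurableType d) (R : realType)
    (m : {measure set T -> \bar R}) (p : T -> R) :
  measurable_fun setT p -> (forall x, 0 <= p x) -> (\int[m]_x (p x)%:E = 1)%E ->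
  exists nu : probability T R,
    forall A, measurable A -> nu A = (\int[m]_(x in A) (p x)%:E)%E.
Proof.
move=> mp p0 p1; pose f (A : set T) := (\int[m]_(x in A) (p x)%:E)%E.
have f0 : f set0 = 0%E by rewrite /f integral_set0.
have f_ge0 A : (0 <= f A)%E by apply: integral_ge0 => x _; rewrite lee_fin.
have fs : semi_sigma_additive f.
  move=> /= F mF tF mUF; rewrite /f; apply: cvg_toP.
    apply: ereal_nondecreasing_is_cvgn => i j ij.
    by apply: lee_sum_nneg_natr => // k _ _; exact: f_ge0.
  rewrite ge0_integral_bigcup//=.
  - by apply: measurable_funTS; exact/measurable_EFinP.
  - by move=> x _; rewrite lee_fin.
pose nu : {measure set T -> \bar R} := HB.pack f (isMeasure.Build _ _ _ f f0 f_ge0 fs).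
pose Pnu : probability T R := HB.pack f nu (Measure_isProbability.Build _ _ _ nu p1).
by exists Pnu.
Qed.

Lemma ge0_integral_even (R : realType) (f : R -> \bar R) : measurable_fun setT f ->
  (forall x, 0 <= f x)%E -> (forall x, f (- x)%R = f x) ->
  (\int[lebesgue_measure]_x f x =
   2%:E * \int[lebesgue_measure]_(x in `[0%R, +oo[) f x)%E.
Proof.
move=> mf f0 fe.
have mfA A : measurable_fun A f by exact: measurable_funTS.
rewrite -(setUv `[0, +oo[) ge0_integral_setU//=; last 3 first.
- exact: measurableC.
- exact: mfA.
- exact/disj_setPCl.
rewrite mule_natl mule2n; congr (_ + _)%E.
rewrite setCitvr integral_itv_bndo_bndc// [RHS]ge0_integral_oppr//.
rewrite opp_preimage_itvbndy oppr0.
by apply: eq_integral => x _; rewrite fe.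
Qed.

Lemma integral_sqr (R : realType) (a b : R) : a < b ->
  (\int[lebesgue_measure]_(x in `[a, b]) (x ^+ 2)%:E = ((b ^+ 3 - a ^+ 3) / 3)%:E)%E.
Proof.
move=> ab; pose F (x : R) := 3^-1 * x ^+ 3.
have dF (x : R) : is_derive x 1 F (x ^+ 2).
  have dX3 := @is_deriveX R R id 3 x 1 1 (is_derive_id x 1).
  apply: (is_derive_eq (@is_deriveZ _ _ _ _ (3^-1 : R) _ _ _ dX3)).
  by rewrite /GRing.scale /= mulr1 mulrA mulVf ?mul1r// pnatr_eq0.
have cF (x : R) : {for x, continuous F}.
  by have [/derivable1_diffP/differentiable_continuous] := dF x.
rewrite (@continuous_FTC2 R (fun x : R => x ^+ 2) F)//.
- by rewrite /F -EFinB; congr (_%:E); field.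
- by apply: continuous_subspaceT => x; exact: exprn_continuous.
- split; [by move=> x _; have [] := dF x|exact/cvg_at_right_filter/cF|
    exact/cvg_at_left_filter/cF].
- by move=> x _; rewrite derive1E; have [_ ->] := dF x.
Qed.

Section bulk.
Context {R : realType}.
Local Notation mu := (@lebesgue_measure R).
Variable g : R -> R.
Hypotheses (mg : measurable_fun setT g) (g0 : forall x, 0 <= g x).

Definition add_bulk (b beta x : R) : R := g x + beta * \1_(`[- b, b] : set R) x.

Lemma measurable_add_bulk b beta : measurable_fun setT (add_bulk b beta).
Proof. by apply: measurable_funD => //; apply: measurable_funM. Qed.

Lemma add_bulk_ge b beta x : 0 <= beta -> g x <= add_bulk b beta x.
Proof. by move=> beta0; rewrite lerDl mulr_ge0. Qed.

Lemma add_bulk_le b beta x : 0 <= beta -> add_bulk b beta x <= g x + beta.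
Proof. by move=> beta0; rewrite lerD2l ler_piMr// indicE; case: (_ \in _). Qed.

Lemma add_bulk_even b beta : (forall x, g (- x) = g x) ->
  forall x, add_bulk b beta (- x) = add_bulk b beta x.
Proof.
move=> g_even x; rewrite /add_bulk g_even !indicE; congr (_ + _ * (nat_of_bool _)%:R).
by rewrite !mem_setE !in_itv/= -!ler_norml normrN.
Qed.

Lemma integralM_add_bulk b beta (h : R -> R) : 0 <= beta -> measurable_fun setT h ->
  (forall x, 0 <= h x) ->
  (\int[mu]_x (h x * add_bulk b beta x)%:E = \int[mu]_x (h x * g x)%:E +
    beta%:E * \int[mu]_(x in `[(- b)%R, b]) (h x)%:E)%E.
Proof.
move=> beta0 mh h0.
have mEh D : measurable_fun D (EFin \o h) by apply: measurable_funTS; exact/measurable_EFinP.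
under eq_integral do rewrite /add_bulk mulrDr EFinD.
rewrite ge0_integralD//.
- congr (_ + _)%E; rewrite -ge0_integralZl//; last 2 first.
    exact: mEh.
    by move=> x _; rewrite lee_fin.
  rewrite [RHS]integral_mkcond; apply: eq_integral => x _.
  rewrite patchE indicE; case: ifPn => xb /=; last by rewrite !mulr0.
  by rewrite mulr1 -EFinM mulrC.
- by move=> x _; rewrite lee_fin mulr_ge0.
- by apply/measurable_EFinP; exact: measurable_funM.
- by move=> x _; rewrite lee_fin !mulr_ge0.
- by apply/measurable_EFinP; apply: measurable_funM => //; exact: measurable_funM.
Qed.

Lemma add_bulk_standardized (m v : R) : m < 1 -> v < 1 ->
  (\int[mu]_x (g x)%:E = m%:E)%E -> (\int[mu]_x (x ^+ 2 * g x)%:E = v%:E)%E ->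
  exists b beta, [/\ 0 < b, 0 < beta, (\int[mu]_x (add_bulk b beta x)%:E = 1)%E &
    (\int[mu]_x (x ^+ 2 * add_bulk b beta x)%:E = 1)%E].
Proof.
move=> m1 v1 intg intg2; have [m1' v1'] : 0 < 1 - m /\ 0 < 1 - v by lra.
pose b := Num.sqrt (3 * (1 - v) / (1 - m)).
have b2 : b ^+ 2 = 3 * (1 - v) / (1 - m).
  by rewrite sqr_sqrtr// divr_ge0 ?mulr_ge0// ltW.
have b0 : 0 < b by rewrite sqrtr_gt0 divr_gt0 ?mulr_gt0.
pose beta := (1 - m) / (2 * b).
have beta0 : 0 < beta by rewrite divr_gt0 ?mulr_gt0.
have [mN0 bN0] : 1 - m != 0 /\ b != 0 by rewrite !gt_eqF.
exists b, beta; split=> //.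
- under eq_integral do rewrite -[add_bulk _ _ _]mul1r.
  rewrite (@integralM_add_bulk b beta (cst 1)) ?(ltW beta0)//.
  under eq_integral do rewrite mul1r.
  rewrite intg (integral_cst mu _ 1)// mul1e [X in (_ * X)%E]lebesgue_measure_itv/= lte_fin gtrN//.
  by rewrite -EFinB -EFinM -EFinD; congr (_%:E); rewrite /beta; field.
- rewrite integralM_add_bulk ?(ltW beta0)//.
  + rewrite intg2 integral_sqr ?gtrN// -EFinM -EFinD; congr (_%:E).
    have -> : beta * ((b ^+ 3 - (- b) ^+ 3) / 3) = (1 - m) * b ^+ 2 / 3.
      by rewrite /beta; field.
    by rewrite b2; field.
  + by move=> x; exact: sqr_ge0.
Qed.

Lemma add_bulk_moment_lty (s b beta : R) : 0 <= s -> 0 <= beta ->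
  (\int[mu]_x (`|x| `^ s * g x)%:E < +oo)%E ->
  (\int[mu]_x (`|x| `^ s * add_bulk b beta x)%:E < +oo)%E.
Proof.
move=> s0 beta0 ints.
have ms := @measurable_normr_powR R s.
rewrite integralM_add_bulk// lte_add_pinfty// lte_mul_pinfty ?lee_fin//.
apply: (@le_lt_trans _ _ (\int[mu]_(x in `[(- b)%R, b]) (`|b| `^ s)%:E)%E).
  apply: ge0_le_integral => //.
  - by apply: measurable_funTS; exact/measurable_EFinP.
  - move=> x /=; rewrite in_itv/= -ler_norml => xb; rewrite lee_fin.
    by rewrite ge0_ler_powR ?nnegrE// (le_trans xb)// ler_norm.
rewrite integral_cst//= lte_mul_pinfty ?lee_fin//.
by rewrite [X in (X < _)%E]lebesgue_measure_itv/=; case: ifP; rewrite ?ltry.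
Qed.

End bulk.

Lemma cvg_ln_powRN (R : realType) (a : R) : 0 < a ->
  (ln x `^ (- a)) @[x --> +oo] --> (0 : R).
Proof.
move=> a0; rewrite (_ : (fun x => _) = (fun x : R => (ln x `^ a)^-1)); last first.
  by apply/funext => x; rewrite powRN.
rewrite gtr0_cvgV0; last first.
  near=> x; apply: powR_gt0; apply: ln_gt0.
  by near: x; exact: nbhs_pinfty_gt.
apply/cvgryPge => A; near=> x.
have Ax : expR (`|A| `^ a^-1) <= x by near: x; exact: nbhs_pinfty_ge.
have lA : `|A| `^ a^-1 <= ln x by rewrite -ler_expR lnK// posrE (lt_le_trans (expR_gt0 _) Ax).
apply: (le_trans (ler_norm A)).
rewrite -[leLHS]powRr1// -[X in _ `^ X](mulVf (lt0r_neq0 a0)) powRrM.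
by apply: ge0_ler_powR; rewrite ?nnegrE ?powR_ge0 ?(ltW a0)// (le_trans _ lA)// powR_ge0.
Unshelve. all: by end_near. Qed.

Section inv_ln_powR.
Context {R : realType}.
Local Notation mu := (@lebesgue_measure R).
Variables eta c : R.
Hypotheses (eta1 : 1 < eta) (c1 : 1 < c).

Let f (x : R) := x^-1 * ln x `^ (- eta).

Let F (x : R) := (1 - eta)^-1 * ln x `^ (1 - eta).

Let dF (x : R) : 1 < x -> is_derive x 1 F (f x).
Proof.
move=> x1; have x0 : 0 < x by exact: lt_trans x1.
have dln := is_derive1_comp (is_derive1_powR (1 - eta) (ln_gt0 x1)) (is_derive1_ln x0).
apply: (is_derive_eq (@is_deriveZ _ _ _ _ (1 - eta)^-1 _ _ _ dln)).
rewrite /GRing.scale/= !mulrA mulVf; last by rewrite lt_eqF// subr_lt0.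
by rewrite mul1r /f mulrC addrAC subrr add0r.
Qed.

Let cF (x : R) : 1 < x -> {for x, continuous F}.
Proof. by move=> /dF[/derivable1_diffP/differentiable_continuous]. Qed.

Let cf : {within `[c, +oo[, continuous f}.
Proof.
apply: continuous_in_subspaceT => x; rewrite inE/= in_itv/= andbT => cx.
have x1 : 1 < x by exact: lt_le_trans cx.
have x0 : 0 < x by exact: lt_trans x1.
apply: (@cvgM _ R^o); first by apply: cvgV; [rewrite gt_eqF|exact: cvg_id].
have [] := is_derive1_comp (is_derive1_powR (- eta) (ln_gt0 x1)) (is_derive1_ln x0).
by move=> /derivable1_diffP/differentiable_continuous.
Qed.

Lemma measurable_inv_ln_powR : measurable_fun `[c, +oo[ f.
Proof. exact: subspace_continuous_measurable_fun. Qed.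

Lemma inv_ln_powR_ge0 x : c <= x -> 0 <= f x.
Proof. by move=> cx; rewrite mulr_ge0// ?powR_ge0// invr_ge0; move: c1; lra. Qed.

Lemma integral_inv_ln_powR :
  (\int[mu]_(x in `[c, +oo[) (f x)%:E = ((eta - 1)^-1 * ln c `^ (1 - eta))%:E)%E.
Proof.
rewrite (@ge0_continuous_FTC2y _ f F _ 0).
- by rewrite -EFinB sub0r /F -mulNr -invrN opprB.
- exact: inv_ln_powR_ge0.
- exact: cf.
- rewrite -[X in _ --> X](mulr0 (1 - eta)^-1).
  apply: (@cvgM _ R^o); first exact: cvg_cst.
  by rewrite -opprB; apply: cvg_ln_powRN; rewrite subr_gt0.
- by move=> x cx; have [] := dF (lt_trans c1 cx).
- exact/cvg_at_right_filter/cF.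
- move=> x; rewrite in_itv/= andbT => cx.
  by rewrite derive1E; have [_ ->] := dF (lt_trans c1 cx).
Qed.

End inv_ln_powR.

Section log_tail.
Context {R : realType}.
Local Notation mu := (@lebesgue_measure R).
Variables (eta s : R).
Hypotheses (eta1 : 1 < eta) (s0 : 0 <= s).

(* The factor [(eta - 1) / 4] gives the [s]-th moment the value [1 / 2]. *)
Definition log_tail (x : R) : R := if expR 1 <= `|x| then
  (eta - 1) / 4 * (`|x| `^ (- (s + 1)) * ln `|x| `^ (- eta)) else 0.

Let k0 : 0 < (eta - 1) / 4. Proof. by rewrite divr_gt0// subr_gt0. Qed.

Let expR1_gt1 : 1 < expR 1 :> R. Proof. by rewrite expR_gt1. Qed.

Lemma log_tail_ge0 x : 0 <= log_tail x.
Proof.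
rewrite /log_tail; case: ifP => // _.
by rewrite (mulr_ge0 (ltW k0))// mulr_ge0 ?powR_ge0.
Qed.

Lemma log_tail_even x : log_tail (- x) = log_tail x.
Proof. by rewrite /log_tail normrN. Qed.

Lemma measurable_log_tail : measurable_fun setT log_tail.
Proof.
have mn : measurable_fun [set: R] (fun x : R => `|x|) by exact: normr_measurable.
apply: measurable_fun_ifT => //; first exact: measurable_fun_ler.
apply: measurable_funM => //; apply: measurable_funM.
  exact: (measurableT_comp (measurable_powR _)).
apply: (measurableT_comp (measurable_powR _)).
exact: (measurableT_comp (@measurable_ln R)).
Qed.

Lemma log_tail_le x : log_tail x <= (eta - 1) / 4.
Proof.
rewrite /log_tail; case: ifPn => [ex|_]; last exact: ltW.
have x1 : 1 <= `|x| by apply: le_trans ex; exact: ltW.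
have l1 : 1 <= ln `|x| by rewrite -[leLHS]expRK ler_ln ?posrE ?expR_gt0// (lt_le_trans ltr01).
rewrite ler_piMr ?(ltW k0)// mulr_ile1 ?powR_ge0//.
  by rewrite -[leRHS](powRr0 `|x|); apply: ler_powR => //; move: s0; lra.
by rewrite -[leRHS](powRr0 (ln `|x|)); apply: ler_powR => //; move: eta1; lra.
Qed.

Let measurable_moment (r : R) : 
  measurable_fun setT (fun x : R => (`|x| `^ r * log_tail x)%:E).
Proof.
apply/measurable_EFinP; apply: measurable_funM; last exact: measurable_log_tail.
exact: measurable_normr_powR.
Qed.

Let moment_ge0 (r x : R) : (0 <= (`|x| `^ r * log_tail x)%:E)%E.
Proof. by rewrite lee_fin mulr_ge0 ?powR_ge0// log_tail_ge0. Qed.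

Lemma integral_log_tail_powR :
  (\int[mu]_x (`|x| `^ s * log_tail x)%:E = 2^-1%:E)%E.
Proof.
rewrite ge0_integral_even//; last by move=> x; rewrite normrN log_tail_even.
transitivity (2%:E * ((eta - 1) / 4)%:E * (eta - 1)^-1%:E)%E; last first.
  by rewrite -!EFinM; congr (_%:E); field; rewrite subr_eq0 gt_eqF.
rewrite -muleA; congr (_ * _)%E; have := integral_inv_ln_powR eta1 expR1_gt1.
rewrite expRK powR1 mulr1 => <-; rewrite -ge0_integralZl//; last 3 first.
- by apply/measurable_EFinP; exact: measurable_inv_ln_powR.
- by move=> x; rewrite /= in_itv/= andbT lee_fin => ex; exact: inv_ln_powR_ge0 ex.
- by rewrite lee_fin ltW.
rewrite [LHS]integral_mkcond [RHS]integral_mkcond; apply: eq_integral => x _.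
rewrite !patchE !mem_setE !in_itv/= !andbT.
have [ex|ex] := leP (expR 1) x; last first.
  by case: ifPn => // x0; rewrite /log_tail ger0_norm// (lt_geF ex) mulr0.
have x0 : 0 < x by apply: lt_le_trans ex; exact: expR_gt0.
rewrite (ltW x0) /log_tail gtr0_norm// ex -EFinM; congr (_%:E).
rewrite mulrCA; congr (_ * _); rewrite mulrA; congr (_ * _).
rewrite -powRD; last by rewrite (gt_eqF x0) implybT.
by rewrite opprD addrA subrr add0r powR_inv1// ltW.
Qed.

Lemma log_tail_moment_le (r : R) : 0 <= r -> r <= s ->
  (\int[mu]_x (`|x| `^ r * log_tail x)%:E <= 2^-1%:E)%E.
Proof.
move=> r0 rs; rewrite -integral_log_tail_powR; apply: ge0_le_integral => //.
- exact: measurable_moment.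
- exact: measurable_moment.
move=> x _; rewrite lee_fin; have [ex|ex] := leP (expR 1) `|x|; last first.
  by rewrite /log_tail (lt_geF ex) !mulr0.
by rewrite ler_wpM2r ?log_tail_ge0// ler_powR// (le_trans (ltW expR1_gt1)).
Qed.

Lemma log_tail_moment_lt1 (r : R) : 0 <= r -> r <= s -> exists2 m : R, m < 1 &
  (\int[mu]_x (`|x| `^ r * log_tail x)%:E = m%:E)%E.
Proof.
move=> r0 rs; have := log_tail_moment_le r0 rs; set I := (\int[_]_x _)%E => I_le.
have I0 : (0 <= I)%E by apply: integral_ge0 => x _; exact: moment_ge0.
have Ifin : I \is a fin_num by rewrite ge0_fin_numE// (le_lt_trans I_le)// ltry.
by exists (fine I); rewrite ?fineK// -lte_fin fineK// (le_lt_trans I_le)// lte_fin; lra.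
Qed.

Lemma log_tail_integral_ge (u : R) : expR 1 *+ 2 <= u ->
  (((eta - 1) / 8 * (u `^ (- s) * ln u `^ (- eta)))%:E <=
  \int[mu]_(x in `](u / 2)%R, +oo[) (log_tail x)%:E)%E.
Proof.
move=> eu; have u0 : 0 < u.
  by apply: lt_le_trans eu; rewrite pmulrn_lgt0// expR_gt0.
have mt A : measurable_fun A (fun x : R => (log_tail x)%:E).
  by apply: measurable_funTS; apply/measurable_EFinP; exact: measurable_log_tail.
pose c := (eta - 1) / 4 * (u `^ (- (s + 1)) * ln u `^ (- eta)).
have -> : ((eta - 1) / 8 * (u `^ (- s) * ln u `^ (- eta)))%:E =
    (\int[mu]_(x in `](u / 2)%R, u]) c%:E)%E.
  rewrite integral_cst//= lebesgue_measure_itv/= lte_fin ltr_pdivrMr// ltr_pMr// ltr1n.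
  rewrite -EFinB -EFinM /c; congr (_%:E).
  have -> : u `^ (- s) = u * u `^ (- (s + 1)).
    rewrite -{2}[u]powRr1 ?(ltW u0)// -powRD; last by rewrite (gt_eqF u0) implybT.
    by congr (_ `^ _); ring.
  by field.
apply: (@le_trans _ _ (\int[mu]_(x in `](u / 2)%R, u]) (log_tail x)%:E)%E); last first.
  apply: ge0_subset_integral => //; first exact: mt.
    by move=> x _; rewrite lee_fin log_tail_ge0.
  exact: subset_itvl.
apply: ge0_le_integral => //.
- by move=> x _; rewrite lee_fin (mulr_ge0 (ltW k0))// mulr_ge0 ?powR_ge0.
- exact: mt.
move=> x /=; rewrite in_itv/= => /andP[ux xu].
have ex : expR 1 <= x by move: eu; rewrite -mulr_natr; lra.
have x1 : 1 < x by exact: lt_le_trans ex.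
have x0 : 0 < x by exact: lt_trans x1.
rewrite lee_fin /log_tail gtr0_norm// ex ler_pM2l//.
have lxu : ln x <= ln u by rewrite ler_ln ?posrE.
have lx : 0 < ln x by exact: ln_gt0.
have lu : 0 < ln u by exact: lt_le_trans lxu.
have [s10 eta0] : 0 <= s + 1 /\ 0 <= eta by move: s0 eta1; lra.
by rewrite ler_pM ?powR_ge0// !powRN lef_pV2 ?posrE ?powR_gt0//;
  apply: ge0_ler_powR => //; rewrite nnegrE ltW.
Qed.

End log_tail.

Lemma log_tailed_density (R : realType) (eta s : R) : 1 < eta -> 2 <= s ->
  exists p : R -> R, [/\ measurable_fun setT p, forall x, 0 <= p x,
    forall x, p (- x) = p x & exists M, forall x, p x <= M] /\
  [/\ (\int[lebesgue_measure]_x (p x)%:E = 1)%E,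
      (\int[lebesgue_measure]_x (x ^+ 2 * p x)%:E = 1)%E,
      (\int[lebesgue_measure]_x (`|x| `^ s * p x)%:E < +oo)%E &
      forall u, expR 1 *+ 2 <= u ->
      (((eta - 1) / 8 * (u `^ (- s) * ln u `^ (- eta)))%:E <=
        \int[lebesgue_measure]_(x in `](u / 2)%R, +oo[) (p x)%:E)%E].
Proof.
move=> eta1 s2; have s0 : 0 <= s by lra.
have g0 := log_tail_ge0 s eta1; have mg := measurable_log_tail eta s.
have [m m1 intg] := log_tail_moment_lt1 eta1 (lexx 0) s0.
have {}intg : (\int[lebesgue_measure]_x (log_tail eta s x)%:E = m%:E)%E.
  by rewrite -intg; apply: eq_integral => x _; rewrite powRr0 mul1r.
have [v v1 intg2] := log_tail_moment_lt1 eta1 (ler0n _ 2) s2.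
have {}intg2 : (\int[lebesgue_measure]_x (x ^+ 2 * log_tail eta s x)%:E = v%:E)%E.
  rewrite -intg2; apply: eq_integral => x _.
  by rewrite powR_mulrn// real_normK// num_real.
have [b [beta [b0 beta0 p1 p2]]] := add_bulk_standardized mg g0 m1 v1 intg intg2.
have bulk_ge := fun x => @add_bulk_ge _ (log_tail eta s) b beta x (ltW beta0).
have p0 x : 0 <= add_bulk (log_tail eta s) b beta x by exact: le_trans (bulk_ge x).
have mp := measurable_add_bulk mg b beta.
exists (add_bulk (log_tail eta s) b beta); split; split=> //.
- by apply: add_bulk_even; exact: log_tail_even.
- exists ((eta - 1) / 4 + beta) => x; apply: le_trans (add_bulk_le _ _ _ (ltW beta0)) _.
  by rewrite lerD2r log_tail_le.
- apply: add_bulk_moment_lty => //; first exact: ltW.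
  by rewrite integral_log_tail_powR// ltry.
- move=> u eu; apply: le_trans (log_tail_integral_ge eta1 s0 eu) _.
  apply: ge0_le_integral => //.
  + by move=> x _; rewrite lee_fin.
  + by apply: measurable_funTS; exact/measurable_EFinP.
  + by apply: measurable_funTS; exact/measurable_EFinP.
  + by move=> x _; rewrite lee_fin.
Qed.

Lemma exists_iid_density (R : realType) (p : R -> R) : measurable_fun setT p ->
  (forall x, 0 <= p x) -> (\int[lebesgue_measure]_x (p x)%:E = 1)%E ->
  exists (d : measure_display) (T : measurableType d) (P : probability T R)
    (X : nat -> {RV P >-> R}),
    iid P (fun i => X i : T -> R) /\ is_density P (X 0%N) p.
Proof.
move=> mp p0 p1; have [nu nuE] := exists_probability_density (m := lebesgue_measure) mp p0 p1.
have [d [T [P [X [iidX X0]]]]] := exists_iid_sequence nu.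
by exists d, T, P, X; split=> //; split=> // A mA; rewrite X0// nuE.
Qed.

(** * The rate of convergence *)

Section rates.
Context {R : realType}.

Definition entropy_rate (eta s N : R) : R :=
  (N * ln N) `^ ((s - 2) / 2) * ln N `^ eta.

Lemma ln_powR_le_powR (a b x : R) : 0 < a -> 0 < b -> 1 <= x ->
  ln x `^ a <= (a / b) `^ a * x `^ b.
Proof.
move=> a0 b0 x1; have x0 : 0 < x by exact: lt_le_trans x1.
have lnx : ln x <= a / b * x `^ (b / a).
  have := ltW (ln_sublinear (powR_gt0 (b / a) x0)); rewrite ln_powR => lnx.
  have := ler_wpM2l (ltW (divr_gt0 a0 b0)) lnx.
  by rewrite mulrA mulrA divfK ?gt_eqF// divff ?mul1r// gt_eqF.
apply: (@le_trans _ _ ((a / b * x `^ (b / a)) `^ a)).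
  by apply: ge0_ler_powR; rewrite ?nnegrE ?(ltW a0) ?ln_ge0// mulr_ge0 ?powR_ge0 ?divr_ge0// ltW.
by rewrite powRM ?powR_ge0// ?(divr_ge0 (ltW a0) (ltW b0))// -powRrM divfK ?gt_eqF.
Qed.

Lemma near_ln_powR_le (K a : R) : 0 < a ->
  \forall n \near \oo, K * ln n%:R `^ a <= n%:R :> R.
Proof.
move=> a0; pose B := `|K| * (a / 2^-1) `^ a.
near=> n; have n1 : 1 <= n%:R :> R by rewrite ler1n; near: n; exact: nbhs_infty_gt.
have B2n : B ^+ 2 <= n%:R by near: n; exact: nbhs_infty_ger.
have Bn : B <= Num.sqrt n%:R.
  by rewrite -[B]ger0_norm ?mulr_ge0 ?powR_ge0// -sqrtr_sqr ler_wsqrtr.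
have half0 : 0 < 2^-1 :> R by [].
have := ln_powR_le_powR a0 half0 n1; rewrite powR12_sqrt// => lnn.
apply: (@le_trans _ _ (`|K| * ln n%:R `^ a)).
  by rewrite ler_wpM2r ?powR_ge0// ler_norm.
apply: le_trans (ler_wpM2l (normr_ge0 K) lnn) _.
by rewrite mulrA -/B -[leRHS]sqr_sqrtr// expr2 ler_wpM2r.
Unshelve. all: by end_near. Qed.

Lemma near_ln_ge1 : \forall n \near \oo, 1 <= ln n%:R :> R.
Proof.
near=> n; have en : expR 1 <= n%:R :> R by near: n; exact: nbhs_infty_ger.
by rewrite -[leLHS]expRK ler_ln ?posrE ?(lt_le_trans _ en) ?expR_gt0.
Unshelve. all: by end_near. Qed.

Lemma tail_rate_ge (eta s k N u : R) : 0 <= eta -> s <= 4 -> 0 <= k -> 0 < N ->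
  1 <= ln N -> 48 * ln N <= N -> 0 <= u -> u ^+ 2 = 48 * (N * ln N) ->
  k / (2 * 48 ^+ 2) / entropy_rate eta s N <=
  ln N * (N / 2 * (k * (u `^ (- s) * ln u `^ (- eta)))).
Proof.
move=> eta0 s4 k0 N0 l1 lN u_ge0 u2; rewrite /entropy_rate.
have lnle x : 0 < x -> x <= N -> ln x <= ln N by move=> x0 xN; rewrite ler_ln.
move: (ln N) l1 lN u2 lnle => l l1 lN u2 lnle.
have l0 : 0 < l by lra.
have A0 : 0 < N * l by exact: mulr_gt0.
have u0 : 0 < u by rewrite lt_neqAle u_ge0 andbT eq_sym -sqrf_eq0 u2 gt_eqF// mulr_gt0.
have uN : u <= N by rewrite -(ler_pXn2r (n := 2)) ?nnegrE ?(ltW N0)// u2 expr2; nra.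
have u1 : 1 < u by rewrite -(ltr_pXn2r (n := 2)) ?nnegrE// u2 expr1n; nra.
set X := (N * l) `^ _; have X0 : 0 < X by exact: powR_gt0.
set Y := l `^ eta; have Y0 : 0 < Y by exact: powR_gt0.
have us : u `^ s <= 48 ^+ 2 * (N * l * X).
  have -> : u `^ s = 48 `^ (s / 2) * (N * l * X).
    rewrite /X -{1}(powRr1 (ltW A0)) -powRD.
      rewrite (_ : 1 + (s - 2) / 2 = s / 2); last by field.
      rewrite -powRM ?(ltW A0)// -u2 -powR_mulrn// -powRrM.
      by congr (_ `^ _); field.
    by rewrite (gt_eqF A0) implybT.
  apply: ler_wpM2r; first by rewrite (mulr_ge0 (ltW A0))// ltW.
  by rewrite -powR_mulrn//; apply: ler_powR; lra.
have uXV : (48 ^+ 2 * (N * l * X))^-1 <= u `^ (- s).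
  by rewrite powRN lef_pV2 ?posrE ?powR_gt0// (lt_le_trans _ us)// powR_gt0.
have YV : Y^-1 <= ln u `^ (- eta).
  have lu : 0 < ln u by exact: ln_gt0.
  rewrite powRN lef_pV2 ?posrE ?powR_gt0//.
  by apply: ge0_ler_powR; rewrite ?nnegrE ?(ltW lu) ?(ltW l0)// lnle.
have -> : k / (2 * 48 ^+ 2) / (X * Y) =
    l * (N / 2 * (k * ((48 ^+ 2 * (N * l * X))^-1 * Y^-1))).
  by field; rewrite !gt_eqF.
apply: (ler_wpM2l (ltW l0)); apply: ler_wpM2l; first by rewrite divr_ge0 ?ltW.
apply: (ler_wpM2l k0); apply: ler_pM => //; last by rewrite invr_ge0 ltW.
by rewrite invr_ge0 !mulr_ge0// ltW.
Qed.

Lemma near_expR_le_rate (eta s c : R) : 0 <= eta -> s <= 4 -> 0 < c ->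
  \forall n \near \oo, Num.sqrt 2 * expR (ln n%:R - 12 * ln n%:R / 4) <=
    c / entropy_rate eta s n%:R.
Proof.
move=> eta0 s4 c0; have eta1 : 0 < 1 + eta by lra.
near=> n; have l1 : 1 <= ln n%:R :> R by near: n; exact: near_ln_ge1.
have ln_small : 2 / c * ln n%:R `^ (1 + eta) <= n%:R :> R.
  by near: n; exact: near_ln_powR_le.
have n1 : 1 <= n%:R :> R by rewrite ler1n; near: n; exact: nbhs_infty_gt.
have n0 : 0 < n%:R :> R by exact: lt_le_trans n1.
have l0 : 0 < ln n%:R :> R by exact: lt_le_trans l1.
have -> : expR (ln n%:R - 12 * ln n%:R / 4) = (n%:R ^+ 2)^-1 :> R.
  have -> : ln n%:R - 12 * ln n%:R / 4 = - (ln n%:R * 2) :> R by field.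
  by rewrite expRN expRM_natr lnK.
rewrite /entropy_rate; set X := _ `^ ((s - 2) / 2); set Y := ln _ `^ _.
have [X0 Y0] : 0 < X /\ 0 < Y by split; rewrite powR_gt0// mulr_gt0.
have XA : X <= n%:R * ln n%:R.
  by apply: ler1_powR; [rewrite -[leLHS]mulr1 ler_pM|lra].
have lY : ln n%:R `^ (1 + eta) = ln n%:R * Y.
  by rewrite powRD ?(gt_eqF l0) ?implybT// powRr1// ltW.
have sqrt2 : Num.sqrt 2 <= 2 :> R.
  by rewrite -[leRHS]ger0_norm// -sqrtr_sqr ler_sqrt// expr2; lra.
rewrite ler_pdivrMr ?exprn_gt0// mulrAC ler_pdivlMr ?mulr_gt0//.
apply: (@le_trans _ _ (2 * (n%:R * (ln n%:R * Y)))).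
  by rewrite ler_pM ?mulr_ge0 ?(ltW X0) ?(ltW Y0)// mulrA ler_wpM2r// ltW.
rewrite -lY expr2 mulrCA [leRHS]mulrCA ler_pM2l//.
by move: ln_small; rewrite -ler_pdivlMl ?divr_gt0// invf_div mulrC; lra.
Unshelve. all: by end_near. Qed.

End rates.

Section symmetric_tails.
Context d (T : measurableType d) (R : realType) (P : probability T R).
Variable X : {RV P >-> R}.
Hypothesis symX : symmetric_law X.

Lemma symmetric_law_tail (t : R) : P [set w | X w < - t] = P [set w | t < X w].
Proof.
rewrite -[in RHS]preimage_itvoy symX//; congr (P _).
by rewrite preimage_itvoy; apply/seteqP; split=> w /=; rewrite ltrNr.
Qed.

Lemma symmetric_law_chebyshev (t : R) : 0 < t -> ('E_P[X] = 0)%E ->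
  (2%:E * P [set w | (t < X w)%R] <= (t ^- 2)%:E * 'V_P[X])%E.
Proof.
move=> t0 EX; have := chebyshev X t0; rewrite EX/=; apply: le_trans.
rewrite mule_natl mule2n -[X in (_ + X)%E]symmetric_law_tail -measureU; last 3 first.
- exact: measurable_set_ltr.
- exact: measurable_set_ltr.
- by rewrite -subset0 => w [/=]; lra.
rewrite le_measure ?inE//.
- by apply: measurableU; exact: measurable_set_ltr.
- by apply: measurable_set_ler => //; apply: measurableT_comp => //; exact: measurable_funB.
- by move=> w /= Xw; rewrite subr0 ler_normr; apply/orP; case: Xw => Xw; [left|right]; lra.
Qed.

End symmetric_tails.

Section entropic_lower_bound.
Context d (T : measurableType d) (R : realType) (P : probability T R).
Variable X : nat -> {RV P >-> R}.
Hypothesis iidX : iid P (fun i => X i : T -> R).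
Hypothesis symX : symmetric_law (X 0%N).
Hypothesis X2 : (X 0%N : T -> R) \in Lfun P 2%:E.
Hypothesis EX : ('E_P[X 0%N] = 0)%E.
Hypothesis VX : ('V_P[X 0%N] = 1)%E.

Lemma D_normalized_sum_ge (n : nat) (L r : R) : (0 < n)%N -> 0 <= L -> 0 <= r ->
  2 <= r ^+ 2 ->
  (L%:E * ((n%:R / 2)%:E * P [set w | (r * Num.sqrt n%:R < X 0%N w)%R]) -
    (Num.sqrt 2 * expR (L - r ^+ 2 / 4))%:E <=
  D P (normalized_sum (fun i => X i : T -> R) n))%E.
Proof.
move=> n0 L0 r0 r2; set t := r * _; have nR0 : 0 < n%:R :> R by rewrite ltr0n.
have sqrtn0 : 0 < Num.sqrt n%:R :> R by rewrite sqrtr_gt0.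
have r_gt0 : 0 < r by rewrite lt_neqAle r0 andbT eq_sym -sqrf_eq0; lra.
have t0 : 0 < t by exact: mulr_gt0.
pose q := fine (P [set w | t < X 0%N w]).
have qE : P [set w | t < X 0%N w] = q%:E.
  by rewrite fineK// fin_num_measure//; exact: measurable_set_ltr.
have q0 : 0 <= q by exact: fine_ge0.
have nq : n%:R * (2 * q) <= 2^-1.
  have := symmetric_law_chebyshev symX t0 EX.
  rewrite VX mule1 qE -EFinM lee_fin exprMn sqr_sqrtr// => q_le.
  apply: le_trans (ler_wpM2l (ltW nR0) q_le) _.
  by rewrite invfM mulrCA divff ?gt_eqF// mulr1 lef_pV2 ?posrE//; lra.
have up i : P [set w | t < X i w] = q%:E.
  by rewrite -qE -!preimage_itvoy; exact: (iidX.2 i _ (measurable_itv _)).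
have down i : P [set w | X i w < - t] = q%:E.
  rewrite -qE -symmetric_law_tail//.
  exact: (iidX.2 i `]-oo, - t[%classic (measurable_itv _)).
have jump := big_jump n iidX.1 (ltW t0) up down.
have EZ := normalized_sum_expectation iidX X2 n EX.
have VZ : 'V_P[normalized_sum (fun i => X i : T -> R) n] = (1 ^+ 2)%:E.
  by rewrite (normalized_sum_variance iidX X2 n0) VX expr1n.
have := D_ge_tail ltr01 L EZ VZ r0; rewrite expr1n; apply: le_trans.
apply: leeB => //; rewrite lee_wpmul2l ?lee_fin//.
rewrite [X in (_ <= P X)%E](_ : _ = [set w | t < `|\sum_(i < n) X i w|]); last first.
  by apply/seteqP; split=> w /=; rewrite subr0 /normalized_sum normf_div
    (gtr0_norm sqrtn0) ltr_pdivlMr.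
apply: le_trans jump; rewrite qE -EFinM lee_fin -mulrA ler_wpM2l//.
by rewrite mulrC ler_wpM2l//; lra.
Qed.

Section log_tailed.
Variables eta s k : R.
Hypotheses (eta0 : 0 <= eta) (s4 : s <= 4) (k0 : 0 < k).
Hypothesis tail : forall u, expR 1 *+ 2 <= u ->
  ((k * (u `^ (- s) * ln u `^ (- eta)))%:E <= P [set w | (u / 2 < X 0%N w)%R])%E.

Let c := k / (4 * 48 ^+ 2).

(* For [u / 2 = sqrt (12 n ln n)] the error term [expR (l - 12 l / 4)] of
   [D_normalized_sum_ge] is [n ^- 2]. *)
Let D_ge_rate (n : nat) (N := n%:R : R) (l := ln N) : (0 < n)%N -> 1 <= l ->
  48 * l <= N -> (expR 1 *+ 2) ^+ 2 <= N ->
  Num.sqrt 2 * expR (l - 12 * l / 4) <= c / entropy_rate eta s N ->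
  ((c / entropy_rate eta s N)%:E <=
    D P (normalized_sum (fun i => X i : T -> R) n))%E.
Proof.
move=> n0 l1 lN eN error_le; have N1 : 1 <= N by rewrite ler1n.
pose u := Num.sqrt (48 * (N * l)).
have u2 : u ^+ 2 = 48 * (N * l) by rewrite sqr_sqrtr//; nra.
have eu : expR 1 *+ 2 <= u.
  rewrite -(ler_pXn2r (n := 2)) ?nnegrE ?mulrn_wge0 ?expR_ge0 ?sqrtr_ge0// u2.
  by apply: le_trans eN _; nra.
pose r := Num.sqrt (12 * l).
have r2 : r ^+ 2 = 12 * l by rewrite sqr_sqrtr//; lra.
have u_half : u / 2 = r * Num.sqrt N.
  rewrite -sqrtrM; last by lra.
  rewrite -[2](ger0_norm (ler0n _ _)) -sqrtr_sqr -sqrtrV// -sqrtrM; last by nra.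
  by congr Num.sqrt; field.
have [l0 r_ge2] : 0 <= l /\ 2 <= r ^+ 2 by rewrite r2; lra.
have := D_normalized_sum_ge n0 l0 (sqrtr_ge0 _) r_ge2; rewrite r2; apply: le_trans.
rewrite -(addrK (c / entropy_rate eta s N) (c / _)) EFinB leeB ?lee_fin// -mulrDl.
rewrite -u_half; apply: (@le_trans _ _ (l * (N / 2 * (k * (u `^ (- s) * ln u `^ (- eta)))))%:E).
  rewrite lee_fin (_ : c + c = k / (2 * 48 ^+ 2)); last by rewrite /c; field.
  by apply: tail_rate_ge => //; [exact: ltW|lra|exact: sqrtr_ge0].
rewrite EFinM lee_pmul2l ?lte_fin//; last by lra.
rewrite EFinM lee_pmul2l ?lte_fin ?divr_gt0//; last by lra.
exact: tail.
Qed.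

Lemma D_normalized_sum_rate : \forall n \near \oo,
  ((k / (4 * 48 ^+ 2) / entropy_rate eta s n%:R)%:E <=
    D P (normalized_sum (fun i => X i : T -> R) n))%E.
Proof.
have c0 : 0 < c by rewrite divr_gt0// mulr_gt0// exprn_gt0.
near=> n; have l1 : 1 <= ln n%:R :> R by near: n; exact: near_ln_ge1.
apply: D_ge_rate => //.
- by near: n; exact: nbhs_infty_gt.
- rewrite -[ln _]powRr1 ?(le_trans ler01)//.
  by near: n; exact: near_ln_powR_le.
- by near: n; exact: nbhs_infty_ger.
- by near: n; exact: near_expR_le_rate.
Unshelve. all: by end_near. Qed.

End log_tailed.

End entropic_lower_bound.

Theorem theorem1p3 (R : realType) (eta : R) (heta : 1 < eta) :
  exists c : R, 0 < c /\
  forall s : R, 2 < s -> s < 4 ->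
  exists (d : measure_display) (T : measurableType d) (P : probability T R)
         (X : nat -> {RV P >-> R}),
    iid P (fun i => (X i : T -> R)) /\
        ('E_P[X 0%N] = 0)%E /\
        ('E_P[fun w => (X 0%N w ^+ 2)%R] = 1)%E /\
        ('E_P[fun w => (`|X 0%N w| `^ s)%R] < +oo)%E /\
        (D P (X 0%N) < +oo)%E /\
        (exists n1 : nat, forall n : nat, (n1 <= n)%N ->
          ((c / ((n%:R * ln n%:R) `^ ((s - 2) / 2) * (ln n%:R) `^ eta))%:E
             <= D P (normalized_sum (fun i => (X i : T -> R)) n))%E).
Proof.
pose k := (eta - 1) / 8; have k0 : 0 < k by rewrite divr_gt0// subr_gt0.
exists (k / (4 * 48 ^+ 2)); split=> [|s s2 s4].
  by rewrite divr_gt0// mulr_gt0// exprn_gt0.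
have [p [[mp p0 p_even [M pM]] [p1 p2 ps p_tail]]] := log_tailed_density heta (ltW s2).
have [d [T [P [X [iidX Xp]]]]] := exists_iid_density mp p0 p1.
have symX := even_density_symmetric Xp p_even.
have [X2 EX EX2 VX] := even_density_moments Xp p_even p2.
exists d, T, P, X; do 3 (split=> //); split; last split.
- have ms := @measurable_normr_powR R s.
  by rewrite (ge0_expectation_density Xp ms)// => x; exact: powR_ge0.
- by apply: (D_bounded_density_lty ltr01 EX _ Xp pM); rewrite VX expr1n.
have eta0 : 0 <= eta by lra.
have [u /p_tail|n1 _ n1P] :=
    @D_normalized_sum_rate _ _ _ _ _ iidX symX X2 EX VX _ s k eta0 (ltW s4) k0.
  by have [_ _ <-//] := Xp; rewrite preimage_itvoy.
by exists n1 => n; exact: n1P.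
Qed.
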